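(* Let $K$ be an arbitrary field of characteristic $0$ with the trivial derivation, let $\mathbf{x}=x_1,\ldots,x_n$ and $\mathbf{u}=u_1,\ldots,u_m$ be differential indeterminates over $K$, and let $\mathbf{f}=f_1,\ldots,f_n$ and $\mathbf{g}=g_1,\ldots,g_s$ be polynomials in $K[\mathbf{x},\mathbf{u}]$. If $d>0$ is an upper bound for the degrees of $\mathbf{f}$ and $\mathbf{g}$, then $$1\in[\dot{\mathbf{x}}-\mathbf{f},\mathbf{g}]\subseteq K\{\mathbf{x},\mathbf{u}\}\quad\Longleftrightarrow\quad1\in(\dot{\mathbf{x}}-\mathbf{f},\ldots,\mathbf{x}^{(L+1)}-\mathbf{f}^{(L)},\mathbf{g},\ldots,\mathbf{g}^{(L)}),$$ where $L\le((n+m)d)^{2^{c(n+m)^3}}$ for a suitable universal constant $c>0$.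
   Context: $K\{\mathbf{x},\mathbf{u}\}$ is the differential polynomial ring $K[x_j^{(p)},u_k^{(p)}:p\in\mathbb{N}_0]$ with derivation $x_j^{(p)}\mapsto x_j^{(p+1)}$, $u_k^{(p)}\mapsto u_k^{(p+1)}$ and $K$ as constants; $\dot z=z^{(1)}$, $h^{(p)}$ and $\mathbf{h}^{(p)}$ denote $p$-th total derivatives. $[\cdot]$ denotes the differential ideal generated, and $(\cdot)$ the ordinary polynomial ideal in the polynomial ring over $K$ in the finitely many variables involved. *)

(* Defs.v *)
From HB Require Import structures.
From mathcomp Require Import all_boot all_algebra.
From mathcomp Require Import finmap.
From mathcomp Require Import monalg.
Set Implicit Arguments. Unset Strict Implicit. Unset Printing Implicit Defensive.
Import GRing.Theory.
Local Open Scope ring_scope.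

(* Differential variables: (inl j, p) is x_j^(p), (inr k, p) is u_k^(p). *)
Definition dvar (n m : nat) : choiceType := (('I_n + 'I_m)%type * nat)%type.

Definition dpoly (K : fieldType) (n m : nat) := {malg K[{cmonom (dvar n m)}]}.

Definition dX (K : fieldType) n m (v : dvar n m) : dpoly K n m := << ucm v >>.

Definition shiftv n m (v : dvar n m) : dvar n m := (v.1, v.2.+1).

Definition dder_mon (K : fieldType) n m (mo : {cmonom (dvar n m)})
  : dpoly K n m :=
  \sum_(v <- finsupp mo)
     (mo v)%:R *: << mulcm (divcm mo (ucm v)) (ucm (shiftv v)) >>.

(* The derivation of K{x,u}: K-linear extension, K the constants
   (trivial derivation on K), x_j^(p) |-> x_j^(p+1), u_k^(p) |-> u_k^(p+1). *)
Definition dder (K : fieldType) n m (h : dpoly K n m) : dpoly K n m :=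
  \sum_(mo <- msupp h) h@_mo *: dder_mon K mo.

Definition dderN (K : fieldType) n m (p : nat) (h : dpoly K n m) :=
  iter p (@dder K n m) h.

Definition dvars (K : fieldType) n m (h : dpoly K n m) : pred (dvar n m) :=
  fun v => has (fun mo : {cmonom (dvar n m)} => v \in finsupp mo) (msupp h).

Definition vars_in (K : fieldType) n m (P : pred (dvar n m)) (h : dpoly K n m) :=
  forall v, dvars h v -> P v.

Definition in_Kxu (K : fieldType) n m (h : dpoly K n m) :=
  vars_in (fun v : dvar n m => v.2 == 0%N) h.

Definition tdeg (K : fieldType) n m (h : dpoly K n m) : nat :=
  \max_(mo <- msupp h) mdeg mo.

Definition is_ideal (K : fieldType) n m (I : dpoly K n m -> Prop) :=
  [/\ I 0, (forall a b, I a -> I b -> I (a + b)) &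
      (forall r a, I a -> I (r * a))].

Definition is_diff_ideal (K : fieldType) n m (I : dpoly K n m -> Prop) :=
  is_ideal I /\ (forall a, I a -> I (dder a)).

Definition diff_ideal_gen (K : fieldType) n m (F : seq (dpoly K n m))
  (r : dpoly K n m) : Prop :=
  forall I, is_diff_ideal I -> (forall h, h \in F -> I h) -> I r.

(* (F): the ordinary ideal generated by the finite family F in the
   polynomial ring over K in the finitely many variables occurring in F:
   r = sum_i a_i F_i with the a_i in that polynomial ring. *)
Definition poly_ideal_gen (K : fieldType) n m (F : seq (dpoly K n m))
  (r : dpoly K n m) : Prop :=
  exists a : seq (dpoly K n m),
    size a = size F /\
    (forall c, c \in a -> vars_in (fun v => has (fun h => dvars h v) F) c) /\
    r = \sum_(i < size F) a`_i * F`_i.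

Definition lhs_gens (K : fieldType) n m s (f : 'I_n -> dpoly K n m)
  (g : 'I_s -> dpoly K n m) : seq (dpoly K n m) :=
  [seq dX K (inl j, 1%N) - f j | j <- enum 'I_n] ++ [seq g k | k <- enum 'I_s].

Definition rhs_gens (K : fieldType) n m s (L : nat) (f : 'I_n -> dpoly K n m)
  (g : 'I_s -> dpoly K n m) : seq (dpoly K n m) :=
  [seq dX K (inl j, i.+1) - dderN i (f j) | i <- iota 0 L.+1, j <- enum 'I_n]
  ++ [seq dderN i (g k) | i <- iota 0 L.+1, k <- enum 'I_s].

(* Main.v *)
Require Import Defs.
From HB Require Import structures.
From mathcomp Require Import all_boot all_fingroup all_algebra.
From mathcomp Require Import finmap monalg.
From mathcomp Require Import generic_quotient ring_quotient fraction separable.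
From mathcomp Require Import boolp.
From mathcomp Require classical_sets.
From mathcomp Require Import ring zify.
Set Implicit Arguments. Unset Strict Implicit. Unset Printing Implicit Defensive.
Import GRing.Theory.
Local Open Scope ring_scope.

(** Let Z be a set of order-zero variables and S its complement.  One shows by
    induction on Z that the prolonged ideal contains a nonzero element of K[S]
    of bounded degree; for S empty this is a nonzero constant.

    For every z in Z the induction hypothesis, applied to a smaller Z, gives a
    relation p_z between z and S, involving only states when z is a state.  For
    a state z, let h be the squarefree part of p_z in z, so that r h^e = s p_z
    with r free of z.  Ritt's argument puts r^(e+1) (h')^(2e-1) in the ideal
    after e further derivations, and x' = f turns it into an element w_z of
    order zero.  If the ideal generated by the p_z, the w_z and g did not meet
    K[S], it would lie in a prime ideal P not meeting K[S], and each z would be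
    algebraic over K(S) in the fraction field E of K[x,u]/P.  There is then a
    derivation of E with x |-> f (the vanishing of w_z is exactly what makes it
    well defined), hence a zero of the differential ideal in E, which cannot
    contain 1.  So the ideal meets K[S], and maximal minors of Sylvester-type
    matrices produce an element of bounded degree: eliminating one variable
    turns the degree D into 2 D^2.

    The induction has n (m + 1) + m + 1 steps, since eliminating a state makes
    all the inputs available again.  The exponential bound needs
    (n + m) d > 1; otherwise it is 0 or 1 and the claim is checked directly. *)

(** * Polynomials of bounded degree in given variables *)

(** The prime ideal argument is not effective: it yields some nonzero element of the ideal free of
    Z, without control of its degree. Such an element serves only as a witness that not all maximal
    minors vanish. The degree comes from the generators p_z, w_z and g, which are bounded
    beforehand.

    States and inputs behave differently because x' can be rewritten as f while nothing replaces u'.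
    The derivative of a relation therefore returns to order zero only when no input occurs in it,
    which is why a state needs a relation in states alone and all inputs are put back into Z for it.
    For an input the value of u' is free, so implicit differentiation merely prescribes it and no
    element w_z arises.

    Implicit differentiation divides by h'(z), so multiple roots have to be removed while the
    coefficients stay polynomials of bounded degree; h is therefore read off from minors of a matrix
    of syzygies of p_z and its derivative. Characteristic zero makes h' coprime to h and permits the
    division by integers in Ritt's argument. *)

Section BoundedPolynomials.
Variables (K : fieldType) (V : choiceType).
Local Notation R := {malg K[{cmonom V}]}.
Implicit Types (h : R) (T : pred V) (v : V) (c : K) (mo : {cmonom V}).

Definition bd T (D : nat) : pred R :=
  fun h => all (fun mo : {cmonom V} => (mdeg mo <= D)%N && all T (finsupp mo)) (msupp h).

Lemma bdP T D h :
  reflect (forall mo, mo \in msupp h ->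
             (mdeg mo <= D)%N /\ (forall v, v \in finsupp mo -> T v)) (bd T D h).
Proof.
apply: (iffP allP) => H mo /H => [/andP[-> /allP //]|[-> HT]].
by rewrite /=; apply/allP.
Qed.

Lemma bdC T c : bd T 0 c%:MP.
Proof.
apply/bdP => mo; rewrite msuppC; case: (c == 0); first by rewrite in_fset0.
by rewrite in_fset1 => /eqP ->; rewrite mdeg1 mdom1; split => // v; rewrite in_fset0.
Qed.

Lemma bdX T v : T v -> bd T 1 << ucm v >>.
Proof.
move=> Tv; apply/bdP => mo; rewrite msuppU1 in_fset1 => /eqP ->.
by rewrite mdegU mdomU; split=> // w; rewrite in_fset1 => /eqP ->.
Qed.

Lemma bd_sub T T' D D' h : {subset T <= T'} -> (D <= D')%N ->
  bd T D h -> bd T' D' h.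
Proof.
move=> sT leD /bdP H; apply/bdP => mo /H[le HT]; split; first exact: leq_trans leD.
by move=> v /HT; apply: sT.
Qed.

Lemma bdW T D D' h : (D <= D')%N -> bd T D h -> bd T D' h.
Proof. exact: bd_sub. Qed.

Lemma bdD T D h1 h2 : bd T D h1 -> bd T D h2 -> bd T D (h1 + h2).
Proof.
move=> /bdP H1 /bdP H2; apply/bdP => mo /(fsubsetP (msuppD_le _ _)).
by rewrite in_fsetU => /orP[/H1|/H2].
Qed.

Lemma bdM T D D' h1 h2 : bd T D h1 -> bd T D' h2 -> bd T (D + D') (h1 * h2).
Proof.
move=> /bdP H1 /bdP H2; apply/bdP => mo /msuppM_le[m1 [m2 [/H1[l1 s1] /H2[l2 s2] ->]]].
rewrite mdegM mdomD leq_add //; split=> // v.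
by rewrite in_fsetU => /orP[/s1|/s2].
Qed.

Lemma bdN T D h : bd T D h -> bd T D (- h).
Proof. by move=> /bdP H; apply/bdP => mo; rewrite msuppN; apply: H. Qed.

Lemma bd0 T D : bd T D 0.
Proof. by apply/bdP => mo; rewrite msupp0 in_fset0. Qed.

Lemma bd1 T D : bd T D 1.
Proof. exact: bdW (bdC T 1). Qed.

Lemma bdB T D h1 h2 : bd T D h1 -> bd T D h2 -> bd T D (h1 - h2).
Proof. by move=> H1 /bdN; apply: bdD. Qed.

Lemma bdMn T D h k : bd T D h -> bd T D (h *+ k).
Proof. by move=> Hh; elim: k => [|k IH]; rewrite ?mulr0n ?bd0 // mulrS bdD. Qed.

Lemma bd_sum T D (I : Type) (r : seq I) (P : pred I) (F : I -> R) :
  (forall i, P i -> bd T D (F i)) -> bd T D (\sum_(i <- r | P i) F i).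
Proof. by move=> H; elim/big_ind: _ => [|x y|//]; [exact: bd0|exact: bdD]. Qed.

Lemma bdXn T D h k : bd T D h -> bd T (D * k) (h ^+ k).
Proof.
move=> Hh; elim: k => [|k IH]; first by rewrite expr0 muln0 bd1.
by rewrite exprS mulnS bdM.
Qed.

Lemma bd_prod T D (I : finType) (F : I -> R) :
  (forall i, bd T D (F i)) -> bd T (D * #|I|) (\prod_i F i).
Proof.
move=> H; rewrite cardE -big_enum /=.
elim: (enum I) => [|i r IH]; first by rewrite big_nil bd1.
by rewrite big_cons mulnS bdM.
Qed.

Lemma bd_det T D q (A : 'M[R]_q) :
  (forall i j, bd T D (A i j)) -> bd T (D * q) (\det A).
Proof.
move=> H; apply: bd_sum => s _; rewrite -signr_odd mulr_sign.
suff Hp : bd T (D * q) (\prod_i A i (s i)) by case: ifP => // _; apply: bdN.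
by rewrite -[X in (D * X)%N]card_ord bd_prod.
Qed.

Lemma monomE mo v : v \in finsupp mo -> mo = mulcm (ucm v) (divcm mo (ucm v)).
Proof.
move=> vmo; apply/eqP/cmP => w; rewrite mulcmE ucmE divcmE ucmE subnKC //.
by case: eqVneq => // <-; rewrite lt0n cmE_neq0.
Qed.

(** Each term is a coefficient times variables peeled off one at a time, so constants (degree 0) and
    variables (degree 1) generate everything under sums and products. Indexing [Pr] by the degree
    lets later degree bounds follow from the same induction. *)
Lemma bd_ind T (Pr : nat -> R -> Prop) :
  (forall c, Pr 0 c%:MP) -> (forall v, T v -> Pr 1 << ucm v >>) ->
  (forall D a b, Pr D a -> Pr D b -> Pr D (a + b)) ->
  (forall D D' a b, Pr D a -> Pr D' b -> Pr (D + D')%N (a * b)) ->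
  (forall D D' a, (D <= D')%N -> Pr D a -> Pr D' a) ->
  forall D h, bd T D h -> Pr D h.
Proof.
move=> PC PX PD PM PW D h /bdP H; rewrite (monalgE h) big_seq.
elim/big_ind: _ => [||mo /H[Dmo Tmo]]; first by rewrite -malgC0E; apply: (PW) (leq0n D) (PC 0).
  exact: PD.
have -> : << h@_mo *g mo >> = (h@_mo)%:MP * << mo >> :> R.
  by rewrite malgM_def fgmulUU mulr1 mul1m.
rewrite -[D]add0n; apply: (PM) => //; apply: (PW) Dmo _.
elim: (mdeg mo) {-2}mo (erefl (mdeg mo)) Tmo => [|k IH] {}mo.
  by move=> /mdeg_eq0I -> _; rewrite mdeg1; apply: (PC).
move=> Emo Tmo; have [v vmo] : exists v, v \in finsupp mo.
  apply/fset0Pn; apply: contra_eqN Emo => /eqP E.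
  by rewrite mdegE E big_seq_fset0.
have Eq := monomE vmo; have := mdegM (ucm v) (divcm mo (ucm v)).
rewrite mdegU -[X in mdeg X]Eq Emo => -[Ek].
have -> : << mo >> = << ucm v >> * << divcm mo (ucm v) >> :> R.
  by rewrite malgM_def fgmulUU mulr1 -[mmul _ _]Eq.
rewrite -add1n; apply: (PM); first exact/PX/Tmo.
rewrite [X in Pr X]Ek add0n; apply: IH => [|w]; first by rewrite [RHS]Ek.
rewrite -cmE_neq0 divcmE => Hw.
by apply: Tmo; rewrite -cmE_neq0; apply: contraNneq Hw => ->.
Qed.

Lemma bd_exists T h : (forall mo v, mo \in msupp h -> v \in finsupp mo -> T v) ->
  exists D, bd T D h.
Proof.
move=> H; exists (\max_(mo <- msupp h) mdeg mo); apply/bdP => mo mo_h; split.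
  by apply: leq_bigmax_seq.
by move=> v; apply: H mo_h.
Qed.

Lemma bd_total h : exists D, bd xpredT D h.
Proof. exact: bd_exists. Qed.

Lemma bd_indT T (Pr : R -> Prop) :
  (forall c, Pr c%:MP) -> (forall v, T v -> Pr << ucm v >>) ->
  (forall a b, Pr a -> Pr b -> Pr (a + b)) ->
  (forall a b, Pr a -> Pr b -> Pr (a * b)) ->
  forall D h, bd T D h -> Pr h.
Proof. by move=> *; apply: (@bd_ind T (fun _ => Pr)); eauto. Qed.

Lemma bd_const T D h : (forall v, ~~ T v) -> bd T D h -> exists c, h = c%:MP.
Proof.
move=> noT; move: D h; apply: bd_indT => [c|v|a b [c ->] [c' ->]|a b [c ->] [c' ->]].
- by exists c.
- by rewrite (negPf (noT v)).
- by exists (c + c'); rewrite raddfD.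
- by exists (c * c'); rewrite rmorphM.
Qed.

Section Evaluation.
Variables (C : comNzRingType) (phi : {rmorphism K -> C}) (val : V -> C).

Definition ev_mon mo : C := \prod_(v <- finsupp mo) val v ^+ mo v.

Lemma ev_monEw mo (d : {fset V}) : (finsupp mo `<=` d)%fset ->
  ev_mon mo = \prod_(v <- d) val v ^+ mo v.
Proof.
move=> le; rewrite /ev_mon (big_fset_incl _ le) // => v _.
by rewrite -cmE_eq0 => /eqP ->.
Qed.

Fact ev_mon_morphism : mmorphism ev_mon.
Proof.
split=> [m1 m2|]; last by rewrite /ev_mon mdom1 big_seq_fset0.
rewrite /= {1}/ev_mon mdomD (ev_monEw (fsubsetUl (finsupp m1) (finsupp m2))).
rewrite (ev_monEw (fsubsetUr (finsupp m1) (finsupp m2))) -big_split /=.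
by apply: eq_bigr => v _; rewrite cmM exprD.
Qed.
HB.instance Definition _ := isMultiplicative.Build _ C ev_mon ev_mon_morphism.

(* Sealed, so that unification does not unfold evaluations. *)
Fact ev_key : unit. Proof. exact: tt. Qed.
Definition ev : R -> C := locked_with ev_key (mmap phi ev_mon).

Let evE : ev = mmap phi ev_mon. Proof. exact: locked_withE. Qed.

Fact ev_zmod_morphism : zmod_morphism ev.
Proof. by rewrite evE; apply: raddfB. Qed.

Fact ev_monoid_morphism : monoid_morphism ev.
Proof. by rewrite evE; split; [apply: rmorph1|apply: rmorphM]. Qed.

HB.instance Definition _ := GRing.isZmodMorphism.Build R C ev ev_zmod_morphism.
HB.instance Definition _ := GRing.isMonoidMorphism.Build R C ev ev_monoid_morphism.

Lemma evD : {morph ev : a b / a + b}. Proof. exact: rmorphD. Qed.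

Lemma evM : {morph ev : a b / a * b}. Proof. exact: rmorphM. Qed.

Lemma evC c : ev c%:MP = phi c.
Proof. by rewrite evE; apply: mmapC. Qed.

Lemma evX v : ev << ucm v >> = val v.
Proof.
by rewrite evE mmapU /= rmorph1 mul1r /ev_mon mdomU big_seq_fset1 cmUU expr1.
Qed.

Lemma eq_ev_on T D (F : {rmorphism R -> C}) h :
  (forall c, F c%:MP = phi c) -> (forall v, T v -> F << ucm v >> = val v) ->
  bd T D h -> F h = ev h.
Proof.
move=> FC FX; move: D h; apply: bd_indT => [c|v Tv|a b Ea Eb|a b Ea Eb].
- by rewrite FC evC.
- by rewrite FX // evX.
- by rewrite !rmorphD Ea Eb.
- by rewrite !rmorphM Ea Eb.
Qed.

End Evaluation.

Lemma rmorph_eq_on (C : comNzRingType) T D (F G : {rmorphism R -> C}) h :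
  (forall c, F c%:MP = G c%:MP) -> (forall v, T v -> F << ucm v >> = G << ucm v >>) ->
  bd T D h -> F h = G h.
Proof.
move=> FC FX; move: D h; apply: bd_indT => [c|v Tv|a b Ea Eb|a b Ea Eb].
- by rewrite FC.
- by rewrite FX.
- by rewrite !rmorphD Ea Eb.
- by rewrite !rmorphM Ea Eb.
Qed.

End BoundedPolynomials.

(** * Polynomials read in one chosen variable *)

Section OneVariable.
Variables (K : fieldType) (V : choiceType).
Local Notation R := {malg K[{cmonom V}]}.
Implicit Types (h : R) (c : K) (T : pred V) (v z : V) (Q : {poly R}).

(** A total degree bound in which the main variable has weight one. Since [D - i] is truncated,
    vanishing above [D] is required separately. *)
Definition bdp T (D : nat) Q :=
  forall i, bd T (D - i) Q`_i /\ ((D < i)%N -> Q`_i = 0).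

Lemma bdp_coef T D Q i : bdp T D Q -> bd T D Q`_i.
Proof. by move=> /(_ i)[+ _]; apply: bdW; rewrite leq_subr. Qed.

Lemma bdp_size T D Q : bdp T D Q -> (size Q <= D.+1)%N.
Proof. by move=> H; apply/leq_sizeP => i /(H i).2. Qed.

Lemma bdpW T D D' Q : (D <= D')%N -> bdp T D Q -> bdp T D' Q.
Proof.
move=> le H i; split; first exact: bdW (leq_sub2r i le) (H i).1.
by move=> lti; apply: (H i).2; apply: leq_ltn_trans lti.
Qed.

Lemma bdpD T D Q Q' : bdp T D Q -> bdp T D Q' -> bdp T D (Q + Q').
Proof.
move=> H H' i; rewrite coefD; split; first by rewrite bdD ?(H i).1 ?(H' i).1.
by move=> lti; rewrite (H i).2 // (H' i).2 // addr0.
Qed.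

Lemma bdpM T D D' Q Q' : bdp T D Q -> bdp T D' Q' -> bdp T (D + D') (Q * Q').
Proof.
move=> H H' i; rewrite coefM; split=> [|lti].
  apply: bd_sum => j _; have [le1|gt1] := leqP j D; last first.
    by rewrite (H j).2 // mul0r bd0.
  have [le2|gt2] := leqP (i - j) D'; last by rewrite (H' _).2 // mulr0 bd0.
  apply: bdW (bdM (H j).1 (H' (i - j)%N).1).
  by have := ltn_ord j; rewrite ltnS => lej; rewrite addnBAC // addnBA // -subnDA addnC subnK.
apply: big1 => j _; have [le1|gt1] := leqP j D; last by rewrite (H j).2 // mul0r.
rewrite (H' _).2 ?mulr0 //; have := ltn_ord j; rewrite ltnS => lej.
by rewrite ltn_subRL; apply: leq_ltn_trans lti; rewrite leq_add2r.
Qed.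

Definition tau_val z v : {poly R} := if v == z then 'X else << ucm v >>%:P.
(** The coefficients stay in [R], although [z] no longer occurs in them, so that eliminating several
    variables never changes the type and substituting [z] back recovers the polynomial ([tauK]). *)
Definition tau z : R -> {poly R} := ev (polyC \o @malgC {cmonom V} K) (tau_val z).
HB.instance Definition _ z := GRing.RMorphism.copy (tau z) (ev (polyC \o @malgC {cmonom V} K) (tau_val z)).

Lemma tau_const z c : tau z c%:MP = c%:MP%:P.
Proof. exact: evC. Qed.

Lemma tau_var z v : tau z << ucm v >> = tau_val z v.
Proof. exact: evX. Qed.

Lemma tauC z T D h : ~~ T z -> bd T D h -> tau z h = h%:P.
Proof.
move=> Tz; apply: (rmorph_eq_on (F := tau z) (G := polyC)) => [c|v Tv].
  exact: tau_const.
rewrite /= tau_var /tau_val; case: eqVneq Tv => [->|_ _] //; by rewrite (negPf Tz).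
Qed.

Lemma tauK z h : (tau z h).[<< ucm z >>] = h.
Proof.
have [D Hh] := bd_total h.
pose F := horner_eval (<< ucm z >> : R) \o tau z.
change (F h = idfun h); apply: (rmorph_eq_on _ _ Hh) => [c|v _] /=.
  by rewrite /F /= tau_const /horner_eval hornerC.
rewrite /F /= tau_var /tau_val /horner_eval; case: eqP => [Ev|_].
  by rewrite hornerX Ev.
by rewrite hornerC.
Qed.

Lemma tau_inj z : injective (tau z).
Proof. by move=> a b E; rewrite -[a](tauK z) E tauK. Qed.

Lemma tau_eq0 z h : (tau z h == 0) = (h == 0).
Proof. by rewrite -(inj_eq (@tau_inj z)) rmorph0. Qed.

Lemma tau_bdp z T D h : bd T D h -> bdp [pred v | T v & v != z] D (tau z h).
Proof.
move: D h; apply: bd_ind => [c|v Tv|D a b Ha Hb|D D' a b Ha Hb|D D' a le Ha].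
- move=> i; rewrite tau_const /= coefC; case: i => [|i]; rewrite ?bd0 //=.
  by split=> //; apply: bdC.
- move=> i; rewrite tau_var /tau_val; case: eqP => [_|/eqP vz].
    by rewrite coefX; case: i => [|[|i]]; split; rewrite ?bd0 ?bd1.
  rewrite coefC; case: i => [|i]; split; rewrite ?bd0 //=.
  by apply: bdX; rewrite /= Tv vz.
- rewrite (rmorphD (tau z)); exact: bdpD Ha Hb.
- rewrite (rmorphM (tau z)); exact: bdpM Ha Hb.
- exact: bdpW le Ha.
Qed.

Lemma tau_horner_bd z T D Q : (forall i, bd T D Q`_i) -> T z ->
  bd T (D + (size Q).-1) Q.[<< ucm z >>].
Proof.
move=> H Tz; rewrite horner_coef; apply: bd_sum => i _; apply: bdM => //.
apply: (@bdW _ _ _ (1 * i)); last exact/bdXn/bdX.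
by rewrite mul1n; case: (size Q) i => [[]//|k i]; rewrite -ltnS.
Qed.

(** Only finitely many variables occur; by induction on their list, the leading coefficients in the
    first variable have a nonzero product. *)
Lemma malg_integral h1 h2 : h1 * h2 = 0 -> h1 = 0 \/ h2 = 0.
Proof.
suff H (s : seq V) : forall D1 D2 h1 h2, bd (mem s) D1 h1 -> bd (mem s) D2 h2 ->
    h1 != 0 -> h2 != 0 -> h1 * h2 != 0.
  move=> E; have [->|n1] := eqVneq h1 0; [by left|right].
  have [//|n2] := eqVneq h2 0.
  pose s := [seq v | mo : {cmonom V} <- msupp h1 ++ msupp h2, v <- enum_fset (finsupp mo)].
  have [D1 B1] : exists D, bd (mem s) D h1.
    apply: bd_exists => mo v Hmo Hv; apply/allpairsPdep; exists mo, v.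
    by rewrite mem_cat Hmo.
  have [D2 B2] : exists D, bd (mem s) D h2.
    apply: bd_exists => mo v Hmo Hv; apply/allpairsPdep; exists mo, v.
    by rewrite mem_cat Hmo orbT.
  by have /eqP := H _ _ _ _ _ B1 B2 n1 n2.
elim: s => [|z s IH] D1 D2 {}h1 {}h2 B1 B2 n1 n2.
  have none v : ~~ mem [::] v by [].
  move: n1 n2; have [c1 ->] := bd_const none B1; have [c2 ->] := bd_const none B2.
  move=> n1 n2; apply/eqP => E.
  have /(can_inj (@malgCK _ _))/eqP : (c1 * c2)%:MP = 0%:MP :> R.
    by rewrite mpolyCM E malgC0E.
  rewrite mulf_eq0 => /orP[] /eqP E0; [move: n1|move: n2];
    by rewrite E0 malgC0E eqxx.
rewrite -(tau_eq0 z) (rmorphM (tau z)) /=.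
rewrite -(tau_eq0 z) in n1; rewrite -(tau_eq0 z) in n2.
have sub i h D : bd (mem (z :: s)) D h -> bd (mem s) D (tau z h)`_i.
  move=> /(tau_bdp z)/bdp_coef-/(_ i) H; apply: (bd_sub _ (leqnn D) H) => v.
  by rewrite !inE => /andP[/orP[->|]].
apply/eqP => E; have := mul_lead_coef (tau z h1) (tau z h2).
rewrite E coef0 => /eqP; apply/negP; rewrite -lead_coef_eq0 in n1.
rewrite -lead_coef_eq0 in n2.
exact: IH (sub _ _ _ B1) (sub _ _ _ B2) n1 n2.
Qed.

Lemma malg_mulf_neq0 h1 h2 : h1 != 0 -> h2 != 0 -> h1 * h2 != 0.
Proof.
by move=> n1 n2; apply/eqP => /malg_integral[] E; move: n1 n2; rewrite E eqxx.
Qed.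

Lemma malg_expf_neq0 h k : h != 0 -> h ^+ k != 0.
Proof.
move=> nh; elim: k => [|k IH]; first by rewrite expr0 oner_neq0.
by rewrite exprS malg_mulf_neq0.
Qed.

End OneVariable.

(** * Sylvester-type elimination *)

Inductive span (R : nzRingType) (M : lmodType R) (G : M -> Prop) : M -> Prop :=
| span0 : span G 0
| spanD x y : span G x -> span G y -> span G (x + y)
| spanZ a x : span G x -> span G (a *: x)
| span_gen x : G x -> span G x.

Lemma span_sum (R : nzRingType) (M : lmodType R) (G : M -> Prop) (I : Type)
    (r : seq I) (P : pred I) (F : I -> M) :
  (forall i, P i -> span G (F i)) -> span G (\sum_(i <- r | P i) F i).
Proof. by move=> H; elim/big_ind: _ => //; [exact: span0|exact: spanD]. Qed.

Definition ideal (R : comNzRingType) (I : R -> Prop) :=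
  [/\ I 0, (forall a b, I a -> I b -> I (a + b)) & (forall r a, I a -> I (r * a))].

Inductive idl (R : comNzRingType) (W : R -> Prop) : R -> Prop :=
| idl0 : idl W 0
| idlD x y : idl W x -> idl W y -> idl W (x + y)
| idlM a x : idl W x -> idl W (a * x)
| idl_gen x : W x -> idl W x.

Lemma idl_ideal (R : comNzRingType) (W : R -> Prop) : ideal (idl W).
Proof. by split; [exact: idl0|exact: idlD|exact: idlM]. Qed.

Lemma idl_min (R : comNzRingType) (W I : R -> Prop) :
  ideal I -> (forall w, W w -> I w) -> forall x, idl W x -> I x.
Proof. by move=> [I0 ID IM] sW x; elim=> *; auto. Qed.

Lemma idl_sub (R : comNzRingType) (W W' : R -> Prop) :
  (forall w, W w -> idl W' w) -> forall x, idl W x -> idl W' x.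
Proof. by apply: idl_min; apply: idl_ideal. Qed.

Lemma idl_rmorph (R R' : comNzRingType) (F : {rmorphism R -> R'})
    (W : R -> Prop) (I : R' -> Prop) :
  ideal I -> (forall w, W w -> I (F w)) -> forall x, idl W x -> I (F x).
Proof.
move=> [I0 ID IM] sW x; elim=> [|y z _ Iy _ Iz|a y _ Iy|w /sW //].
- by rewrite rmorph0.
- by rewrite rmorphD; apply: ID.
- by rewrite rmorphM; apply: IM.
Qed.

Section Ideals.
Variables (R : comNzRingType) (J : R -> Prop).
Hypothesis idJ : ideal J.

Lemma ideal0 : J 0. Proof. by case: idJ. Qed.
Lemma idealD a b : J a -> J b -> J (a + b). Proof. by case: idJ => ? + ?; apply. Qed.
Lemma idealM r a : J a -> J (r * a). Proof. by case: idJ => ? ?; apply. Qed.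
Lemma idealMr r a : J a -> J (a * r). Proof. by rewrite mulrC; apply: idealM. Qed.
Lemma idealN a : J a -> J (- a). Proof. by rewrite -mulN1r; apply: idealM. Qed.
Lemma idealB a b : J a -> J b -> J (a - b).
Proof. by move=> Ja /idealN; apply: idealD. Qed.
Lemma ideal_sum (I : Type) (r : seq I) (P : pred I) (F : I -> R) :
  (forall i, P i -> J (F i)) -> J (\sum_(i <- r | P i) F i).
Proof. by move=> H; elim/big_ind: _ => //; [exact: ideal0|exact: idealD]. Qed.

Section DeterminantOfSpan.
Variables (q : nat) (G : 'rV[R]_q -> Prop).
Hypothesis detG : forall A : 'M[R]_q, (forall i, G (row i A)) -> J (\det A).

Let G' (v : 'rV[R]_q) := G v \/ (forall j, J (v 0 j)).

Let detG' (A : 'M[R]_q) : (forall i, G' (row i A)) -> J (\det A).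
Proof.
move=> H; have [[i Hi]|nJ] := pselect (exists i, forall j, J (A i j)).
  rewrite (expand_det_row _ i); apply: ideal_sum => j _.
  by rewrite mulrC; apply: idealM.
apply: detG => i; case: (H i) => // Hi; case: nJ; exists i => j.
by have := Hi j; rewrite mxE.
Qed.

Let set_row (A : 'M[R]_q) (i : 'I_q) (v : 'rV[R]_q) : 'M[R]_q :=
  \matrix_(l, j) if l == i then v 0 j else A l j.

Let row_set A i v : row i (set_row A i v) = v.
Proof. by apply/rowP => j; rewrite !mxE eqxx. Qed.

Let row'_set A i v w : row' i (set_row A i v) = row' i (set_row A i w).
Proof. by apply/matrixP => l j; rewrite !mxE; case: eqP => // E; have := neq_lift i l; rewrite E eqxx. Qed.

(** By multilinearity, rows of the span are replaced by generators one at a time. A row with all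
    entries in [J] puts the determinant into [J] by Laplace expansion; when all rows come from [G],
    [detG] applies. *)
Lemma det_span (A : 'M[R]_q) : (forall i, span G' (row i A)) -> J (\det A).
Proof.
suff H k (B : 'M[R]_q) : (forall i : 'I_q, (i < k)%N -> span G' (row i B)) ->
    (forall i : 'I_q, (k <= i)%N -> G' (row i B)) -> J (\det B).
  by move=> HA; apply: (H q) => // i; rewrite leqNgt ltn_ord.
elim: k B => [|k IH] B HB HB'; first by apply: detG' => i; apply: HB'.
have [ltk|gek] := ltnP k q; last first.
  apply: IH => i lti; first by apply: HB; apply: ltnW.
  by have := leq_trans (ltn_ord i) (leq_trans gek lti); rewrite ltnn.
pose i := Ordinal ltk.
have -> : B = set_row B i (row i B).
  by apply/matrixP => l j; rewrite !mxE; case: eqP => [->|].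
have : span G' (row i B) by apply: HB.
elim: (row i B) / => [|x y _ Hx _ Hy|a x _ Hx|x Gx].
- have := @determinant_multilinear _ _ (set_row B i 0) (set_row B i 0) (set_row B i 0) i 0 0.
  rewrite !mul0r addr0 => ->; rewrite ?row_set ?scaler0 ?addr0 //.
  exact: ideal0.
- have := @determinant_multilinear _ _ (set_row B i (x + y)) (set_row B i x) (set_row B i y) i 1 1.
  rewrite !mul1r !row_set !scale1r => -> //; exact: idealD.
- have := @determinant_multilinear _ _ (set_row B i (a *: x)) (set_row B i x) (set_row B i x) i a 0.
  rewrite !row_set scale0r addr0 mul0r addr0 => -> //; exact: idealM.
apply: IH => l lel.
  have ne : l == i = false by apply/negbTE; rewrite -val_eqE /= neq_ltn lel.
  suff -> : row l (set_row B i x) = row l B by apply: HB; apply: ltnW.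
  by apply/rowP => j; rewrite !mxE ne.
have [->|ne] := eqVneq l i; first by rewrite row_set.
suff -> : row l (set_row B i x) = row l B.
  by apply: HB'; rewrite ltn_neqAle lel andbT eq_sym; move: ne; rewrite -val_eqE.
by apply/rowP => j; rewrite !mxE (negPf ne).
Qed.

End DeterminantOfSpan.
End Ideals.

Section EliminateOneVariable.
Variables (R : comNzRingType) (p : {poly R}) (W : {poly R} -> Prop) (D : nat).
Hypotheses (Dgt0 : (0 < D)%N) (szW : forall w, W w -> (size w <= D.+1)%N).
Hypothesis pn0 : p != 0.
Local Notation rho := (size p).-1.
Local Notation q := (rho + D)%N.
Local Notation lam := (lead_coef p).

(** For a single [w] these are the rows of the Sylvester matrix of [p] and [w], with [D] as formal
    degree of [w]. A minor may mix rows from several [w], so that a whole family is eliminated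
    against [p] at once. *)
Definition sylvester_row (r : {poly R}) : Prop :=
  (exists2 i, (i < D)%N & r = 'X^i * p) \/
  (exists w j, [/\ W w, (j < rho)%N & r = 'X^j * w]).

Definition sylvester_minor (c : R) : Prop :=
  exists2 A : 'I_q -> {poly R}, (forall i, sylvester_row (A i)) &
    c = \det (\matrix_(i, t < q) (A i)`_t).

Let size_p : size p = rho.+1.
Proof. by rewrite prednK // size_poly_gt0. Qed.

Let size_row r : sylvester_row r -> (size r <= q)%N.
Proof.
case=> [[i lti ->]|[w [j [/szW sw ltj ->]]]].
  by rewrite mulrC size_mulXn // size_p addnS -addSn addnC leq_add2l.
have [->|w0] := eqVneq w 0; first by rewrite mulr0 size_poly0.
rewrite mulrC size_mulXn //; apply: leq_trans (leq_add (leqnn j) sw) _.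
by rewrite addnS -addSn leq_add2r.
Qed.

(** Multiplying the matrix by the column of powers of [xi] gives the values of the rows at [xi],
    which lie in [J]. The adjugate then gives the determinant times that column, whose entry of
    index 0 is the determinant itself. *)
Lemma minor_in_ideal (J : R -> Prop) xi c : ideal J -> J p.[xi] ->
  (forall w, W w -> J w.[xi]) -> sylvester_minor c -> J c.
Proof.
move=> idJ Jp JW [A rowA ->]; set M := \matrix_(i, j) _.
have q_gt0 : (0 < q)%N by rewrite addn_gt0 Dgt0 orbT.
pose x : 'cV[R]_q := \col_t xi ^+ t.
have Mx i : (M *m x) i 0 = (A i).[xi].
  rewrite mxE (horner_coef_wide _ (size_row (rowA i))).
  by apply: eq_bigr => t _; rewrite !mxE.
have JA i : J (A i).[xi].
  case: (rowA i) => [[k _ ->]|[w [k [Ww _ ->]]]]; rewrite hornerM; apply: idealM => //.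
  exact: JW.
have : (\adj M *m (M *m x)) (Ordinal q_gt0) 0 = \det M.
  by rewrite mulmxA mul_adj_mx mul_scalar_mx !mxE expr0 mulr1.
move=> <-; rewrite mxE; apply: ideal_sum => // i _; rewrite Mx.
exact: idealM.
Qed.

Section Converse.
Variables (J : R -> Prop) (c : R).
Hypotheses (idJ : ideal J) (minorJ : forall b, sylvester_minor b -> J b).

Let JX (Q : {poly R}) := forall i, J Q`_i.

Let JX_ideal : ideal JX.
Proof.
split=> [i|P Q HP HQ i|P Q HQ i]; first by rewrite coef0; apply: ideal0.
  by rewrite coefD; apply: idealD.
by rewrite coefM; apply: ideal_sum => // j _; apply: idealM.
Qed.

Let gen (r : {poly R}) := JX r \/ exists w j, [/\ W w, (j < rho)%N & r = 'X^j * w].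

(** Normal form modulo [p] and [J]: after scaling by a power of [lam], only shifts of [W] of order
    below the degree of [p] remain. The cofactor [a] is unrestricted here and is cut down by
    [trim]. *)
Let reducible (Q : {poly R}) := exists k (S a : {poly R}), span gen S /\ lam ^+ k *: Q = S + a * p.

Let reducibleD P Q : reducible P -> reducible Q -> reducible (P + Q).
Proof.
move=> [k [S [a [spS E]]]] [k' [S' [a' [spS' E']]]].
exists (k + k')%N, (lam ^+ k' *: S + lam ^+ k *: S'),
  (lam ^+ k' *: a + lam ^+ k *: a'); split.
  by apply: spanD; apply: spanZ.
rewrite scalerDr exprD {1}mulrC -!scalerA E E' !scalerDr mulrDl -!scalerAl.
by rewrite addrACA.
Qed.

Let reducibleZ b Q : reducible Q -> reducible (b *: Q).
Proof.
move=> [k [S [a [spS E]]]]; exists k, (b *: S), (b *: a).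
by split; [apply: spanZ|rewrite scalerA mulrC -scalerA E scalerDr -scalerAl].
Qed.

Let reducible_span S : span gen S -> reducible S.
Proof. by move=> spS; exists 0, S, 0; rewrite mul0r addr0 expr0 scale1r. Qed.

Let reducible_p a : reducible (a * p).
Proof. by exists 0, 0, a; rewrite expr0 scale1r add0r; split => //; apply: span0. Qed.

Let span_mul (P w : {poly R}) : W w -> (size P <= rho)%N -> span gen (P * w).
Proof.
move=> Ww sP; rewrite -[P]coefK poly_def mulr_suml; apply: span_sum => i _.
rewrite -scalerAl; apply/spanZ/span_gen; right; exists w, i; split=> //.
exact: leq_trans sP.
Qed.

Let reducible_unscale Q : reducible (lam *: Q) -> reducible Q.
Proof.
by move=> [k [S [a [spS E]]]]; exists k.+1, S, a; rewrite exprSr -scalerA.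
Qed.

Let reducible_mulXw w j : W w -> (j <= rho)%N -> reducible ('X^j * w).
Proof.
move=> Ww; rewrite leq_eqVlt => /orP[/eqP ->|ltj]; last first.
  by apply/reducible_span/span_gen; right; exists w, j.
apply: reducible_unscale.
(* The factor [lam *: 'X^rho - p] has degree below [rho], so the first summand is spanned by the
   allowed shifts of [w]. *)
have -> : lam *: ('X^rho * w) = (lam *: 'X^rho - p) * w + w * p.
  by rewrite mulrBl -scalerAl [w * p]mulrC subrK.
apply: reducibleD; last exact: reducible_p.
apply: reducible_span; apply: span_mul => //; apply/leq_sizeP => i lei.
rewrite coefB coefZ coefXn; have [->|ne] := eqVneq i rho.
  by rewrite mulr1 lead_coefE subrr.
rewrite mulr0 sub0r nth_default ?oppr0 // size_p ltn_neqAle lei andbT eq_sym.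
exact: ne.
Qed.

Let reducibleX Q : reducible Q -> reducible ('X * Q).
Proof.
have redX S : span gen S -> reducible ('X * S).
  elim=> [|x y _ Hx _ Hy|a x _ Hx|x [Jx|[w [j [Ww ltj ->]]]]].
  - by rewrite mulr0; apply/reducible_span/span0.
  - by rewrite mulrDr; apply: reducibleD.
  - by rewrite -scalerAr; apply: reducibleZ.
  - by apply/reducible_span/span_gen; left; apply: (idealM JX_ideal).
  - by rewrite mulrA -exprS; apply: reducible_mulXw.
move=> [k [S [a [spS E]]]].
have [k' [S' [a' [spS' E']]]] := redX S spS.
exists (k' + k)%N, S', (a' + lam ^+ k' *: ('X * a)); split=> //.
rewrite exprD -scalerA scalerAr E mulrDr scalerDr E' mulrDl addrA.
by congr (_ + _); rewrite -scalerAl mulrA.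
Qed.

Let reducible_ideal : ideal reducible.
Proof.
split; [exact: reducible_span (span0 _)|exact: reducibleD|].
elim/poly_ind => [|P b IH] Q HQ; first by rewrite mul0r; exact/reducible_span/span0.
rewrite mulrDl; apply: reducibleD; last by rewrite mul_polyC; apply: reducibleZ.
by rewrite -mulrA; apply/IH/reducibleX.
Qed.

Let reducible_gen Q : JX Q \/ W Q \/ Q = p -> reducible Q.
Proof.
case=> [JQ|[WQ|->]]; first by apply/reducible_span/span_gen; left.
  by have := reducible_mulXw WQ (leq0n rho); rewrite expr0 mul1r.
by have := reducible_p 1; rewrite mul1r.
Qed.

Let big (Q : {poly R}) := forall i, (q <= i)%N -> J Q`_i.

Let span_big S : span gen S -> big S.
Proof.
elim=> [|x y _ Hx _ Hy|a x _ Hx|x [Jx|[w [j [Ww ltj ->]]]]] i lei.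
- by rewrite coef0; apply: ideal0.
- by rewrite coefD; apply: idealD => //; [apply: Hx|apply: Hy].
- by rewrite coefZ; apply: idealM => //; apply: Hx.
- exact: Jx.
rewrite nth_default; first exact: ideal0.
by apply: leq_trans lei; apply: size_row; right; exists w, j.
Qed.

(** While [a] has size above [D], the formal top coefficient [lead_coef a * lam] of [a * p] has
    index at least [q] and so lies in [J]. After scaling by [lam], the top term of [a] can thus be
    dropped modulo [J]. *)
Let trim (a : {poly R}) : big (a * p) ->
  exists k (a' : {poly R}), (size a' <= D)%N /\ JX (lam ^+ k *: a - a').
Proof.
have [s] := ubnP (size a); elim: s a => // s IH a lts Ha.
have [le|gt] := leqP (size a) D.
  by exists 0, a; rewrite expr0 scale1r subrr; split=> // i; rewrite coef0; apply: ideal0.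
set N := (size a).-1; have sa : size a = N.+1 by rewrite prednK // (leq_trans _ gt).
have Jtop : J (lead_coef a * lam).
  have := Ha (N + rho)%N; rewrite mul_lead_coef sa size_p addnS addSn /=; apply.
  by rewrite addnC leq_add2r -ltnS -sa.
pose a2 := lam *: a - (lam * lead_coef a) *: 'X^N.
have sza2 : (size a2 < s)%N.
  rewrite -ltnS; apply: leq_trans lts; rewrite sa !ltnS.
  apply/leq_sizeP => i lei; rewrite coefB !coefZ coefXn.
  have [->|ne] := eqVneq i N; first by rewrite mulr1 lead_coefE subrr.
  rewrite mulr0 subr0 [a`_i]nth_default ?mulr0 // sa ltn_neqAle lei andbT eq_sym.
  exact: ne.
have [|k [a' [sza' Ha']]] := IH a2 sza2.
  move=> i lei; rewrite /a2 mulrBl -!scalerAl coefB !coefZ.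
  by apply: idealB => //; [apply: idealM => //; apply: Ha|rewrite mulrC [lam * _]mulrC; apply: idealM].
exists k.+1, a'; split=> // i.
have -> : lam ^+ k.+1 *: a - a' =
    (lam ^+ k *: a2 - a') + lam ^+ k *: ((lam * lead_coef a) *: 'X^N).
  by rewrite /a2 scalerBr exprSr -scalerA addrAC subrK.
rewrite coefD; apply: idealD => //; rewrite !coefZ; apply: idealM => //.
by rewrite mulrC [lam * _]mulrC; apply: idealM.
Qed.

Let rowG (v : 'rV[R]_q) := exists2 r, sylvester_row r & v = \row_t r`_t.
Let rowG' (v : 'rV[R]_q) := rowG v \/ (forall j, J (v 0 j)).

Let span_rows Q : reducible Q -> (size Q <= q)%N ->
  exists k, span rowG' (\row_(t < q) (lam ^+ k *: Q)`_t).
Proof.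
move=> [k [S [a [spS E]]]] szQ.
have bigap : big (a * p).
  move=> i lei; have -> : a * p = lam ^+ k *: Q - S by rewrite E addrC addKr.
  rewrite coefB coefZ nth_default ?mulr0; last exact: leq_trans lei.
  by rewrite sub0r; apply: idealN => //; apply: span_big.
have [k' [a' [sza' Ha']]] := trim bigap.
exists (k' + k)%N.
have -> : lam ^+ (k' + k) *: Q = lam ^+ k' *: S + (a' * p + (lam ^+ k' *: a - a') * p).
  by rewrite mulrBl [a' * p + _]addrCA subrr addr0 exprD -scalerA E scalerDr -scalerAl.
have rowD (P P' : {poly R}) : \row_(t < q) (P + P')`_t = \row_t P`_t + \row_t P'`_t :> 'rV[R]_q.
  by apply/rowP => t; rewrite !mxE coefD.
have rowZ b (P : {poly R}) : \row_(t < q) (b *: P)`_t = b *: \row_t P`_t :> 'rV[R]_q.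
  by apply/rowP => t; rewrite !mxE coefZ.
have row0 : \row_(t < q) (0 : {poly R})`_t = 0 :> 'rV[R]_q.
  by apply/rowP => t; rewrite !mxE coef0.
rewrite rowD; apply: spanD.
  rewrite rowZ; apply: spanZ; elim: S / spS {E} => [|x y _ Hx _ Hy|b x _ Hx|x [Jx|Hx]].
  - by rewrite row0; apply: span0.
  - by rewrite rowD; apply: spanD.
  - by rewrite rowZ; apply: spanZ.
  - by apply: span_gen; right => j; rewrite mxE.
  - by apply: span_gen; left; exists x => //; right.
rewrite rowD; apply: spanD.
  rewrite -[a']coefK poly_def mulr_suml.
  have : (size a' <= D)%N by [].
  elim/big_ind: _ => [|x y Hx Hy le|i _ le]; first by rewrite row0 => _; apply: span0.
    by rewrite rowD; apply: spanD; [apply: Hx|apply: Hy].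
  rewrite -scalerAl rowZ; apply/spanZ/span_gen; left; exists ('X^i * p) => //.
  by left; exists i => //; apply: leq_trans le.
apply: span_gen; right => j; rewrite mxE coefM; apply: ideal_sum => // i _.
exact: idealMr.
Qed.

(** Each [c *: 'X^t] with t < q becomes, up to a power of [lam], a combination of Sylvester rows
    modulo [J]. Stacking these q rows with a common power of [lam] gives a scalar matrix; its
    determinant lies in [J] because all minors do. *)
Lemma eliminate :
  idl (fun Q => JX Q \/ W Q \/ Q = p) c%:P -> exists k e, J (lam ^+ k * c ^+ e).
Proof.
move=> Hc; have Hred t : reducible (c *: 'X^t).
  rewrite -mul_polyC mulrC; case: reducible_ideal => _ _; apply.
  by apply: idl_min Hc; [exact: reducible_ideal|exact: reducible_gen].
have /fin_all_exists[k Hk] (t : 'I_q) :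
    exists k, span rowG' (\row_(j < q) (lam ^+ k *: (c *: 'X^t))`_j).
  apply: span_rows => //; apply/leq_sizeP => i lei; rewrite coefZ coefXn.
  by case: eqP => [E|]; [have := ltn_ord t; rewrite -E ltnNge lei|rewrite mulr0].
pose k0 := (\sum_t k t)%N; exists (k0 * q)%N, q.
have -> : lam ^+ (k0 * q) * c ^+ q = \det ((lam ^+ k0 * c)%:M : 'M[R]_q).
  by rewrite det_scalar exprMn exprM.
apply: (det_span idJ (G := rowG)) => [A HA|t].
  apply: minorJ; have /fin_all_exists[r Hr] i : exists r, sylvester_row r /\
      row i A = \row_t r`_t by case: (HA i) => r *; exists r.
  exists r => [i|]; first exact: (Hr i).1.
  congr (\det _); apply/matrixP => i j; rewrite mxE.
  by have /rowP/(_ j) := (Hr i).2; rewrite !mxE.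
have le : (k t <= k0)%N by rewrite /k0 (bigD1 t) //= leq_addr.
have -> : row t (lam ^+ k0 * c)%:M =
    lam ^+ (k0 - k t) *: \row_(j < q) (lam ^+ k t *: (c *: 'X^t))`_j :> 'rV[R]_q.
  apply/rowP => j; rewrite !mxE !coefZ coefXn mulrA -exprD subnK // mulrA.
  by rewrite mulr_natr eq_sym.
exact: spanZ.
Qed.

End Converse.
End EliminateOneVariable.

Definition elim_bound k D := iter k (fun D => 2 * (D * D))%N D.

Section Elimination.
Variables (K : fieldType) (V : choiceType).
Local Notation R := {malg K[{cmonom V}]}.
Implicit Types (T : pred V) (z v : V) (W : R -> Prop) (c h : R).

(** The element [c], of uncontrolled degree [Dc], only prevents collapse. It is passed on multiplied
    by a power of the leading coefficient of [pz z], which is nonzero and free of the remaining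
    variables. When no variable remains, a nonzero element of the ideal forces a nonzero member of
    [W], and that member has bounded degree. *)
Lemma elimination T (zs : seq V) (pz : V -> R) D W c Dc :
  uniq zs -> (0 < D)%N -> (forall z, z \in zs -> ~~ T z) ->
  (forall z, z \in zs -> pz z != 0 /\ bd [pred v | T v || (v == z)] D (pz z)) ->
  (forall w, W w -> bd [pred v | T v || (v \in zs)] D w) ->
  c != 0 -> bd [pred v | v \notin zs] Dc c ->
  idl (fun h => W h \/ exists2 z, z \in zs & h = pz z) c ->
  exists c', [/\ c' != 0, bd T (elim_bound (size zs) D) c' &
    idl (fun h => W h \/ exists2 z, z \in zs & h = pz z) c'].
Proof.
elim: zs D W c Dc => [|z zs IH] D W c Dc; rewrite /elim_bound ?iterSr.
  move=> _ D0 _ _ bW cn0 _ Hc.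
  have [[w Ww wn0]|H] := pselect (exists2 w, W w & w != 0).
    exists w; split=> //; last by apply: idl_gen; left.
    by apply: bd_sub (leqnn D) (bW _ Ww) => v; rewrite !inE orbF.
  suff E : c = 0 by rewrite E eqxx in cn0.
  apply: (@idl_min _ _ (fun x => x = 0) _ _ _ Hc).
    by split=> [|a b -> ->|r a ->]; rewrite ?addr0 ?mulr0.
  move=> w [Ww|[] //]; have [//|n0] := eqVneq w 0.
  by case: H; exists w.
move=> /= /andP[zzs uzs] D0 Tzs Hpz HW cn0 bc Hc.
have Tz : ~~ T z by apply: Tzs; rewrite inE eqxx.
have [pzn0 bpz] := Hpz z (mem_head _ _).
pose P := tau z (pz z).
have Pn0 : P != 0 by rewrite tau_eq0.
have bP : bdp T D P.
  move=> i; have := tau_bdp z bpz i => -[H H']; split=> //.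
  apply: bd_sub (leqnn _) H => v; rewrite !inE; case: eqP => [->|] //=.
    by rewrite andbF.
  by rewrite orbF andbT.
pose W1 (Q : {poly R}) := exists2 w, W w & Q = tau z w.
have bW1 Q : W1 Q -> bdp [pred v | T v || (v \in zs)] D Q.
  move=> [w Ww ->] i; have := tau_bdp z (HW _ Ww) i => -[H H']; split=> //.
  apply: bd_sub (leqnn _) H => v; rewrite !inE => /andP[].
  by case: (T v) => //= /orP[->|->].
have sP : (size P <= D.+1)%N := bdp_size bP.
pose minors := sylvester_minor P W1 D.
have szW1 w : W1 w -> (size w <= D.+1)%N by move=> /bW1 /bdp_size.
have bminor m : minors m -> bd [pred v | T v || (v \in zs)] (2 * (D * D)) m.
  move=> [A HA ->].
  (* A minor has order at most [2 * D] and entries of degree at most [D]. *)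
  apply: (@bdW _ _ _ (D * ((size P).-1 + D))%N).
    by rewrite mul2n -addnn mulnDr leq_add2r leq_mul2l; apply/orP; right; lia.
  apply: bd_det => i t; rewrite mxE.
  case: (HA i) => [[k _ ->]|[w [k [/bW1 Hw _ ->]]]]; rewrite coefXnM; case: ifP => _; rewrite ?bd0 //.
    by apply: bd_sub (leqnn D) (bdp_coef _ bP) => v Tv; rewrite !inE; apply/orP; left.
  exact: bdp_coef.
pose G := fun h => minors h \/ exists2 z', z' \in zs & h = pz z'.
have [k [e He]] : exists k e, idl G (lead_coef P ^+ k * c ^+ e).
  apply: (eliminate (D := D) (W := W1)) => //; first exact: idl_ideal.
    by move=> b Hb; apply: idl_gen; left.
  have <- : tau z c = c%:P.
    by apply: (tauC _ bc); rewrite /= inE eqxx.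
  pose F : {rmorphism R -> {poly R}} := tau z.
  set GX := (X in idl X); have idGX : ideal (idl GX) := idl_ideal GX.
  refine (@idl_rmorph R {poly R} F _ (idl GX) idGX _ c Hc).
  move=> w; rewrite -[F w]/(tau z w) => -[Ww|[z' + ->]].
    by apply: idl_gen; right; left; exists w.
  rewrite inE => /orP[/eqP ->|z'zs]; first by apply: idl_gen; right; right.
  apply: idl_gen; left => i.
  have z'in : z' \in z :: zs by rewrite inE z'zs orbT.
  have [_ bz'] := Hpz z' z'in.
  (* For [z'] other than [z], [pz z'] is free of [z]: it is a constant polynomial and belongs to the
     ideal modulo which [z] is eliminated. *)
  rewrite (tauC _ bz') ?coefC; last first.
    by rewrite /= (negPf Tz) /=; apply: contraNneq zzs => ->.
  by case: eqP => _; [apply: idl_gen; right; exists z'|apply: idl0].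
have bl : bd [pred v | v \notin zs] D (lead_coef P).
  apply: bd_sub (leqnn D) (bdp_coef _ bP) => v Tv; rewrite !inE.
  by apply: contraL Tv => vzs; apply: Tzs; rewrite inE vzs orbT.
have bc' : bd [pred v | v \notin zs] Dc c.
  by apply: bd_sub (leqnn Dc) bc => v; rewrite !inE negb_or => /andP[].
have [||z' z'zs|z' z'zs|||||c' [c'n0 bc'' Hc']] :=
  IH (2 * (D * D))%N minors (lead_coef P ^+ k * c ^+ e) (D * k + Dc * e)%N.
- by [].
- by rewrite !muln_gt0 D0.
- by apply: Tzs; rewrite inE z'zs orbT.
- have [|n0 b] := Hpz z'; first by rewrite inE z'zs orbT.
  by split=> //; apply: bdW b; rewrite mulnA leq_pmull // muln_gt0 D0.
- by [].
- by rewrite malg_mulf_neq0 ?malg_expf_neq0 ?lead_coef_eq0.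
- by apply: bdM; apply: bdXn.
- exact: He.
exists c'; split=> //; apply: idl_sub Hc' => m [Hm|[z' z'zs ->]]; last first.
  by apply: idl_gen; right; exists z' => //; rewrite inE z'zs orbT.
apply: (minor_in_ideal D0 szW1 Pn0 (xi := << ucm z >>)) Hm.
- exact: idl_ideal.
- by rewrite tauK; apply: idl_gen; right; exists z => //; rewrite inE eqxx.
- by move=> w [w' Ww' ->]; rewrite tauK; apply: idl_gen; left.
Qed.

End Elimination.

(** * Prime ideals and derivations of residue fields *)

Section PrimeIdeal.
Variables (R : comNzRingType) (I M : R -> Prop).
Hypotheses (idI : ideal I) (MM : forall a b, M a -> M b -> M (a * b)).
Hypothesis disj : forall x, M x -> ~ I x.

Lemma prime_avoiding : exists P : R -> Prop,
  [/\ ideal P, (forall x, I x -> P x), (forall x, M x -> ~ P x) &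
      forall a b, P (a * b) -> P a \/ P b].
Proof.
pose good (A : R -> Prop) := [/\ ideal A, (forall x, I x -> A x) & forall x, M x -> ~ A x].
pose ok (A : R -> Prop) := (forall x, ~ A x) \/ good A.
have [F okF totF|A [okA maxA]] := @classical_sets.Zorn_bigcup R ok.
  have [[A0 FA0 [x0 A0x0]]|none] := pselect (exists2 A, F A & exists x, A x); last first.
    by left=> x [A FA Ax]; apply: none; exists A => //; exists x.
  have goodF A x : F A -> A x -> good A.
    by move=> FA Ax; case: (okF _ FA) => // /(_ x).
  have gA0 := goodF _ _ FA0 A0x0.
  have IA0 x : I x -> A0 x by case: gA0 => _ + _; apply.
  right; split=> [|x Ix|x Mx [A FA Ax]]; last 1 first.
  - by case: (goodF _ _ FA Ax) => _ _ /(_ x Mx).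
  - split=> [|a b [A FA Aa] [B FB Bb]|r a [A FA Aa]].
    + by exists A0 => //; exact: IA0 (ideal0 idI).
    + case: (totF A B FA FB) => sub.
        exists B => //; case: (goodF _ _ FB Bb) => idB _ _.
        by apply: (idealD idB) => //; apply: sub.
      exists A => //; case: (goodF _ _ FA Aa) => idA _ _.
      by apply: (idealD idA) => //; apply: sub.
    + by exists A => //; case: (goodF _ _ FA Aa) => idA _ _; apply: idealM.
  - by exists A0 => //; apply: IA0.
have gA : good A.
  case: okA => // A0; case: (maxA I); last by right.
  by split=> [x /A0 //|/(_ 0 (ideal0 idI)) /A0].
have [idA IA MA] := gA; exists A; split=> // a b Aab.
pose add c x := exists2 y, A y & exists r, x = y + r * c.
have idadd c : ideal (add c).
  split=> [|x y [u Au [r ->]] [v Av [s ->]]|t x [u Au [r ->]]].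
  - by exists 0; [apply: ideal0|exists 0; rewrite mul0r addr0].
  - exists (u + v); first exact: idealD.
    by exists (r + s); rewrite mulrDl addrACA.
  - by exists (t * u); [apply: idealM|exists (t * r); rewrite mulrDr mulrA].
have meets c : ~ A c -> exists2 x, M x & add c x.
  move=> nAc; have [//|H] := pselect (exists2 x, M x & add c x).
  case: (maxA (add c)); last first.
    right; split=> // [x Ix|x Mx addx]; last by case: H; exists x.
    by exists x; [exact: IA|exists 0; rewrite mul0r addr0].
  split=> [x Ax|sub]; first by exists x => //; exists 0; rewrite mul0r addr0.
  by apply/nAc/sub; exists 0; [apply: ideal0|exists 1; rewrite mul1r add0r].
have [Aa|/meets[x Mx [u Au [r Ex]]]] := pselect (A a); first by left.
have [Ab|/meets[y My [v Av [s Ey]]]] := pselect (A b); first by right.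
case: (MA _ (MM Mx My)); rewrite Ex Ey mulrDl; apply: (idealD idA).
  exact: idealMr.
rewrite mulrDr; apply: (idealD idA); first exact: idealM.
by rewrite mulrACA; apply: idealM.
Qed.

End PrimeIdeal.

Section ResidueDomain.
Variables (R : comNzRingType) (I : prime_idealr R).

Definition residue := {ideal_quot I}.
HB.instance Definition _ := GRing.ComNzRing.on residue.

(** Units and inverses are chosen classically, to make the quotient an [idomainType] to which
    [{fraction _}] applies. *)
Definition residue_unit : pred residue := fun x => `[< exists y, y * x = 1 >].
Definition residue_inv (x : residue) : residue :=
  if pselect (exists y, y * x = 1) is left H then sval (cid H) else x.

Fact residue_mulVr : {in residue_unit, left_inverse 1 residue_inv *%R}.
Proof.
move=> x /asboolP H; rewrite /residue_inv; case: pselect => // H'.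
exact: (svalP (cid H')).
Qed.

Fact residue_unitP (x y : residue) : y * x = 1 -> residue_unit x.
Proof. by move=> E; apply/asboolP; exists y. Qed.

Fact residue_invr_out : {in [predC residue_unit], residue_inv =1 id}.
Proof.
by move=> x /asboolP H; rewrite /residue_inv; case: pselect.
Qed.

HB.instance Definition _ :=
  GRing.ComNzRing_hasMulInverse.Build residue residue_mulVr residue_unitP residue_invr_out.
HB.instance Definition _ :=
  GRing.ComUnitRing_isIntegral.Build residue (@Quotient.rquot_IdomainAxiom R I).

End ResidueDomain.

Section ResidueField.
Variables (R : comNzRingType) (P : R -> Prop).
Hypotheses (idP : ideal P) (P1 : ~ P 1) (primeP : forall a b, P (a * b) -> P a \/ P b).

Let S : {pred R} := fun x => `[< P x >].

Let S_idealr : idealr_closed S.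
Proof.
split; first by apply/asboolP; exact: ideal0 idP.
  by apply/asboolP.
move=> a u v /asboolP Pu /asboolP Pv; apply/asboolP.
by apply: idealD => //; apply: idealM.
Qed.

Let S_prime : prime_idealr_closed S.
Proof.
by move=> u v /asboolP /primeP[H|H]; apply/orP; [left|right]; apply/asboolP.
Qed.

HB.instance Definition _ := isIdealr.Build R S S_idealr.
HB.instance Definition _ := isPrimeIdealrClosed.Build R S S_prime.

Lemma residue_field : exists (E : fieldType) (pi : {rmorphism R -> E}),
  (forall x, pi x = 0 <-> P x) /\
  (forall e, exists a b, pi b != 0 /\ e = pi a / pi b).
Proof.
pose Q : idomainType := residue S.
pose pi0 : {rmorphism R -> {ideal_quot S}} := \pi_{ideal_quot S}%qT.
pose pi : {rmorphism R -> {fraction Q}} := @tofrac Q \o (pi0 : {rmorphism R -> Q}).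
have pi_eq0 x : (pi x == 0) = (pi0 x == 0) by rewrite /pi /= tofrac_eq0.
exists {fraction Q}, pi; split=> [x|e].
  split=> [/eqP|Px].
    rewrite pi_eq0 -(rmorph0 pi0) -Quotient.idealrBE subr0.
    by move/asboolP.
  apply/eqP; rewrite pi_eq0 -(rmorph0 pi0) -Quotient.idealrBE subr0.
  exact/asboolP.
elim/quotW: e => x; have d0 := denom_ratioP x.
have pi0K (y : Q) : exists a, pi0 a = y.
  by exists (repr (y : {ideal_quot S})); exact: reprK.
have [a Ea] := pi0K \n_x; have [b Eb] := pi0K \d_x.
have Eb' : pi b = tofrac \d_x by rewrite /pi /= -Eb.
have Ea' : pi a = tofrac \n_x by rewrite /pi /= -Ea.
have b0 : pi b != 0 by rewrite Eb' tofrac_eq0.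
exists a, b; split=> //; apply: (mulIf b0); rewrite divfK // Ea' Eb'.
apply/eqP; rewrite !piE /= /FracField.equivf /FracField.mulf.
have pi1 : \pi_{ideal_quot S}%qT 1 = 1 :> Q := rmorph1 pi0.
by rewrite pi1 !numden_Ratio ?oner_eq0 ?mulr1 //= mulrC.
Qed.
End ResidueField.

Section DerivationOver.
Variables (R E : comNzRingType) (pi : {rmorphism R -> E}).

(** Derivations of [R] into [E] as an [R]-module through [pi]. They can be handled before it is
    known that they factor through the image of [pi]. *)
Definition derivation_over (d : R -> E) : Prop :=
  (forall a b, d (a + b) = d a + d b) /\
  (forall a b, d (a * b) = d a * pi b + pi a * d b).

Variable d : R -> E.
Hypothesis dP : derivation_over d.

Lemma derD a b : d (a + b) = d a + d b. Proof. by case: dP. Qed.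
Lemma derM a b : d (a * b) = d a * pi b + pi a * d b. Proof. by case: dP. Qed.
Lemma der0 : d 0 = 0.
Proof. by apply: (addIr (d 0)); rewrite -derD !add0r. Qed.
Lemma der1 : d 1 = 0.
Proof.
by have := derM 1 1; rewrite mulr1 rmorph1 mulr1 mul1r -[X in X = _]addr0 => /addrI.
Qed.
Lemma derN a : d (- a) = - d a.
Proof. by apply: (addIr (d a)); rewrite -derD !addNr der0. Qed.
Lemma derB a b : d (a - b) = d a - d b. Proof. by rewrite derD derN. Qed.
Lemma der_sum (I : Type) (r : seq I) (P : pred I) (F : I -> R) :
  d (\sum_(i <- r | P i) F i) = \sum_(i <- r | P i) d (F i).
Proof. by apply: big_morph; [exact: derD|exact: der0]. Qed.

Lemma der_horner (Q : {poly R}) z : (forall i, d Q`_i = 0) ->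
  d Q.[z] = pi (Q^`()).[z] * d z.
Proof.
elim/poly_ind: Q => [|Q c IH] HQ.
  by rewrite derivC !horner0 der0 rmorph0 mul0r.
have dc : d c = 0 by have := HQ 0%N; rewrite coefD coefMX coefC add0r.
have dQ i : d Q`_i = 0 by have := HQ i.+1; rewrite coefD coefMX coefC addr0.
rewrite hornerMXaddC derD derM dc addr0 IH // derivMXaddC hornerD hornerMX.
by rewrite rmorphD rmorphM mulrDl mulrAC addrC.
Qed.

End DerivationOver.

Lemma derivation_sub (R E : comNzRingType) (pi : {rmorphism R -> E}) (d d' : R -> E) :
  derivation_over pi d -> derivation_over pi d' ->
  derivation_over pi (fun a => d a - d' a).
Proof.
move=> dP dP'; split=> a b.
  by rewrite (derD dP) (derD dP') opprD addrACA.
by rewrite (derM dP) (derM dP') mulrBl mulrBr opprD addrACA.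
Qed.

Lemma derivation_comp (R E : comNzRingType) (psi : {rmorphism R -> E}) (D : R -> R) :
  derivation_over (idfun : {rmorphism R -> R}) D ->
  derivation_over psi (fun a => psi (D a)).
Proof.
by move=> DP; split=> a b; rewrite ?(derD DP) ?(derM DP) !(rmorphD, rmorphM).
Qed.

Lemma derivation_precomp (R E : comNzRingType) (psi : {rmorphism R -> E}) (D : E -> E) :
  derivation_over (idfun : {rmorphism E -> E}) D ->
  derivation_over psi (fun a => D (psi a)).
Proof.
by move=> DP; split=> a b; rewrite ?rmorphD ?rmorphM ?(derD DP) ?(derM DP).
Qed.

Lemma rmorph_leibniz (R E : comNzRingType) (sg : {rmorphism R -> R})
    (pi : {rmorphism R -> E}) a b x y : sg a = a -> sg b = b ->
  sg (a * b) = a * b /\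
  pi (sg (x * b + a * y)) = pi (sg x) * pi b + pi a * pi (sg y).
Proof. by move=> Ha Hb; rewrite !(rmorphD, rmorphM) Ha Hb. Qed.

Lemma size_sub_lead (R : nzRingType) (Q : {poly R}) : Q != 0 ->
  (size (Q - lead_coef Q *: 'X^((size Q).-1))%R < size Q)%N.
Proof.
rewrite -size_poly_gt0 => sQ.
rewrite -[X in (_ < X)%N](prednK sQ) ltnS; apply/leq_sizeP => i lei.
rewrite coefB coefZ coefXn; have [->|ne] := eqVneq i (size Q).-1.
  by rewrite mulr1 lead_coefE subrr.
rewrite mulr0 subr0 nth_default // -[X in (X <= _)%N](prednK sQ) ltn_neqAle lei.
by rewrite eq_sym ne.
Qed.

Lemma size_pseudo_sub (R : comNzRingType) (P Q : {poly R}) :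
  (0 < size Q)%N -> (size Q <= size P)%N ->
  (size (lead_coef Q *: P - lead_coef P *: ('X^(size P - size Q) * Q))%R < size P)%N.
Proof.
move=> sQ le; have sP : (0 < size P)%N by apply: leq_trans le.
set k := (size P - size Q)%N.
rewrite -[X in (_ < X)%N](prednK sP) ltnS; apply/leq_sizeP => i lei.
rewrite coefB !coefZ coefXnM.
have lei' : (k + (size Q).-1 <= i)%N.
  by apply: leq_trans lei; rewrite -ltnS prednK // -addnS prednK // subnK.
rewrite ltnNge (leq_trans (leq_addr _ _) lei') /=.
have [->|ne] := eqVneq i (size P).-1.
  have -> : ((size P).-1 - k = (size Q).-1)%N by rewrite /k; lia.
  by rewrite -!lead_coefE mulrC subrr.
have lti : ((size P).-1 < i)%N by rewrite ltn_neqAle eq_sym ne.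
rewrite !nth_default ?mulr0 ?subrr //; last by rewrite -(prednK sP).
rewrite leq_subRL; last exact: leq_trans (leq_addr _ _) lei'.
by rewrite /k subnK // -(prednK sP).
Qed.

Section KillAdjoin.
Variables (R : comNzRingType) (E : fieldType) (pi : {rmorphism R -> E}).
Variables (d : R -> E) (A : R -> Prop) (z : R).
Hypotheses (dP : derivation_over pi d) (AB : forall a b, A a -> A b -> A (a - b)).
Hypotheses (A0 : A 0) (AM : forall a b, A a -> A b -> A (a * b)).
Hypothesis dA : forall a, A a -> pi a = 0 -> d a = 0.

Let over (Q : {poly R}) := (forall i, A Q`_i) /\ pi Q.[z] = 0.
Let phi (Q : {poly R}) := d Q.[z].
Let psi (Q : {poly R}) := pi (Q^`()).[z].

(* Both [phi] and [psi] are derivations of [A[X]] restricted to the kernel of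
   evaluation at [z] modulo [ker pi], which has rank one. *)
Let phi_psi P Q : over P -> over Q -> phi P * psi Q = phi Q * psi P.
Proof.
have [s] := ubnP (size P + size Q)%N; elim: s P Q => // s IH P0 Q0; move: P0 Q0.
suff H (P Q : {poly R}) : (size Q <= size P)%N -> (size P + size Q < s.+1)%N ->
    over P -> over Q -> phi P * psi Q = phi Q * psi P.
  move=> P Q lts oP oQ; have [le|/ltnW le] := leqP (size Q) (size P).
    exact: H.
  by apply/esym/H => //; rewrite addnC.
move=> le lts [AP P0] [AQ Q0].
have [->|Qn0] := eqVneq Q 0.
  by rewrite /phi /psi derivC !horner0 (der0 dP) rmorph0 mulr0 mul0r.
have sQ : (0 < size Q)%N by rewrite size_poly_gt0.
(* A leading coefficient killed by [pi] is killed by [d] as well, so dropping the leading term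
   changes neither [phi] nor [psi]. *)
have [l0|ln0] := eqVneq (pi (lead_coef Q)) 0.
  pose Q' := Q - lead_coef Q *: 'X^((size Q).-1).
  have EQ : Q = Q' + lead_coef Q *: 'X^((size Q).-1) by rewrite subrK.
  have sQ' : (size Q' < size Q)%N := size_sub_lead Qn0.
  have eqphi : phi Q = phi Q'.
    rewrite [in LHS]EQ /phi hornerD hornerZ (derD dP) (derM dP) l0 (dA (AQ _) l0).
    by rewrite !mul0r !addr0.
  have eqpsi : psi Q = psi Q'.
    by rewrite [in LHS]EQ /psi derivD derivZ hornerD hornerZ rmorphD rmorphM l0 mul0r addr0.
  rewrite eqphi eqpsi; apply: IH; [by rewrite -ltnS; apply: leq_trans lts; rewrite ltnS ltn_add2l|by []|].
  split=> [i|]; last first.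
    by rewrite /Q' hornerD hornerN hornerZ rmorphB rmorphM l0 mul0r subr0.
  rewrite coefB coefZ coefXn; have [->|ne] := eqVneq i (size Q).-1.
    by rewrite mulr1 lead_coefE subrr.
  by rewrite mulr0 subr0.
pose k := (size P - size Q)%N.
(* As [P] and [Q] vanish at [z] under [pi], the Leibniz rule makes [phi] and [psi] of this
   pseudo-remainder the same combination of their values at [P] and [Q]. The claim passes back to
   [P] because [pi (lead_coef Q)] is invertible. *)
pose T := lead_coef Q *: P - lead_coef P *: ('X^k * Q).
have [->|Pn0] := eqVneq P 0.
  by rewrite /phi /psi derivC !horner0 (der0 dP) rmorph0 mulr0 mul0r.
have sP : (0 < size P)%N by rewrite size_poly_gt0.
have sT : (size T < size P)%N := size_pseudo_sub sQ le.
have phiT : phi T = pi (lead_coef Q) * phi P - pi (lead_coef P * z ^+ k) * phi Q.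
  rewrite /phi /T hornerD hornerN !hornerZ hornerM hornerXn (derB dP) !(derM dP) P0 Q0.
  by rewrite !rmorphM Q0 !mulr0 !add0r mulrA.
have psiT : psi T = pi (lead_coef Q) * psi P - pi (lead_coef P * z ^+ k) * psi Q.
  rewrite /psi /T derivB !derivZ derivM hornerD hornerN !hornerZ hornerD !hornerM hornerXn.
  by rewrite rmorphB !rmorphM rmorphD !rmorphM Q0 mulr0 add0r mulrA.
have oT : over T.
  split=> [i|]; last first.
    by rewrite hornerD hornerN !hornerZ hornerM rmorphB !rmorphM P0 Q0 !mulr0 subrr.
  rewrite coefB !coefZ coefXnM; apply: AB; first exact: AM (AQ _) (AP _).
  by apply: AM (AP _) _; case: ifP.
have : (size T + size Q < s)%N by rewrite -ltnS (leq_trans _ lts) // ltnS ltn_add2r.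
move=> /IH /(_ oT (conj AQ Q0)); rewrite phiT psiT => Eq.
apply: (mulfI ln0); apply/eqP; rewrite -subr_eq0; apply/eqP.
transitivity ((pi (lead_coef Q) * phi P - pi (lead_coef P * z ^+ k) * phi Q) * psi Q
   - phi Q * (pi (lead_coef Q) * psi P - pi (lead_coef P * z ^+ k) * psi Q)); first ring.
by rewrite Eq subrr.
Qed.

(** Uniqueness of derivations on separable extensions: once [d] vanishes on one relation having [z]
    as a simple root, the rank-one identity [phi_psi] makes it vanish on every relation of [z] over
    [A]. *)
Lemma kill_adjoin (H : {poly R}) : (forall i, A H`_i) -> pi H.[z] = 0 -> d H.[z] = 0 ->
  pi (H^`()).[z] != 0 ->
  forall Q : {poly R}, (forall i, A Q`_i) -> pi Q.[z] = 0 -> d Q.[z] = 0.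
Proof.
move=> AH H0 dH H1 Q AQ Q0; have := phi_psi (conj AQ Q0) (conj AH H0).
by rewrite /phi /psi dH mul0r => /eqP; rewrite mulf_eq0 (negPf H1) orbF => /eqP.
Qed.

End KillAdjoin.

Section ExtendToFractions.
Variables (R : comNzRingType) (E : fieldType) (pi : {rmorphism R -> E}) (d : R -> E).
Hypothesis dP : derivation_over pi d.
Hypothesis d_ker : forall a, pi a = 0 -> d a = 0.
Hypothesis fracE : forall e : E, exists a b, pi b != 0 /\ e = pi a / pi b.

(** The quotient rule; it is independent of the chosen fraction because [d_ker] applies to the
    difference of the cross products. *)
Lemma derivation_frac : exists dE : E -> E,
  [/\ forall x y, dE (x + y) = dE x + dE y,
      forall x y, dE (x * y) = dE x * y + x * dE y &
      forall a, dE (pi a) = d a].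
Proof.
have /choice[num Hnum] (e : E) : exists ab : R * R, pi ab.2 != 0 /\ e = pi ab.1 / pi ab.2.
  by have [a [b H]] := fracE e; exists (a, b).
pose q a b := (d a * pi b - pi a * d b) / pi b ^+ 2.
have q_eq a b a' b' : pi b != 0 -> pi b' != 0 -> pi a / pi b = pi a' / pi b' ->
    q a b = q a' b'.
  move=> b0 b0' /eqP; rewrite eqr_div // => /eqP Eq.
  have : d (a * b' - a' * b) = 0 by apply: d_ker; rewrite rmorphB !rmorphM Eq subrr.
  rewrite (derB dP) !(derM dP) => /eqP; rewrite subr_eq0 => /eqP Ed.
  apply/eqP; rewrite eqr_div ?expf_neq0 //; apply/eqP.
  have -> : (d a * pi b - pi a * d b) * pi b' ^+ 2 =
      pi b * pi b' * (d a * pi b' + pi a * d b') - pi b * (pi a * pi b') * d b'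
      - pi b' * d b * (pi a * pi b') by ring.
  by rewrite Ed Eq; ring.
pose dE e := q (num e).1 (num e).2.
have dEq a b : pi b != 0 -> dE (pi a / pi b) = q a b.
  move=> b0; have [n0 En] := Hnum (pi a / pi b).
  exact: q_eq.
exists dE; split=> [x y|x y|a].
- have [a [b [b0 ->]]] := fracE x; have [a' [b' [b0' ->]]] := fracE y.
  have Es : pi a / pi b + pi a' / pi b' = pi (a * b' + a' * b) / pi (b * b').
    by rewrite addf_div // rmorphD !rmorphM.
  rewrite Es !dEq //; last by rewrite rmorphM mulf_neq0.
  rewrite /q (derD dP) !(derM dP) rmorphD !rmorphM.
  by field; rewrite b0 b0'.
- have [a [b [b0 ->]]] := fracE x; have [a' [b' [b0' ->]]] := fracE y.
  have Es : pi a / pi b * (pi a' / pi b') = pi (a * a') / pi (b * b').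
    by rewrite mulf_div !rmorphM.
  rewrite Es !dEq //; last by rewrite rmorphM mulf_neq0.
  rewrite /q !(derM dP) !rmorphM.
  by field; rewrite b0 b0'.
- have -> : pi a = pi a / pi 1 by rewrite rmorph1 divr1.
  rewrite dEq ?rmorph1 ?oner_neq0 // /q (der1 dP) rmorph1.
  by rewrite mulr0 subr0 expr1n mulr1 divr1.
Qed.

End ExtendToFractions.

Section DerivationFromValues.
Variables (K : fieldType) (V : choiceType).
Local Notation R := {malg K[{cmonom V}]}.
Variables (E : comNzRingType) (pi : {rmorphism R -> E}).
Implicit Types (val : V -> E) (h : R).

Lemma derivation_eq_on (T : pred V) D (d d' : R -> E) h :
  derivation_over pi d -> derivation_over pi d' ->
  (forall c, d c%:MP = d' c%:MP) -> (forall v, T v -> d << ucm v >> = d' << ucm v >>) ->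
  bd T D h -> d h = d' h.
Proof.
move=> dP dP' dC dX; move: D h; apply: bd_indT => // [a b Ha Hb|a b Ha Hb].
  by rewrite (derD dP) (derD dP') Ha Hb.
by rewrite (derM dP) (derM dP') Ha Hb.
Qed.

(** Dual numbers: reading only the coefficients 0 and 1 amounts to working modulo the square of
    ['X]. The coefficient of ['X] is the derivation with the prescribed values, and multiplicativity
    of [ev] is its Leibniz rule. *)
Let lift val : R -> {poly E} :=
  ev (polyC \o (pi \o @malgC {cmonom V} K)) (fun v => (pi << ucm v >>)%:P + val v *: 'X).

Definition der val h : E := (lift val h)`_1.

Let lift0 val h : (lift val h)`_0 = pi h.
Proof.
have [D bh] := bd_total h; move: D h bh.
apply: bd_indT => [c|v _|a b Ha Hb|a b Ha Hb].
- by rewrite /lift evC coefC.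
- by rewrite /lift evX coefD coefC coefZ coefX mulr0 addr0.
- by rewrite /lift evD coefD Ha Hb rmorphD.
- by rewrite /lift evM coefM big_ord1 Ha Hb rmorphM.
Qed.

Lemma der_derivation val : derivation_over pi (der val).
Proof.
split=> a b; first by rewrite /der /lift evD coefD.
have Eab : lift val (a * b) = lift val a * lift val b := evM _ _ a b.
rewrite /der Eab coefM !big_ord_recl big_ord0 /= !lift0 addr0 addrC.
by [].
Qed.

Lemma derC val c : der val c%:MP = 0.
Proof. by rewrite /der /lift evC coefC. Qed.

Lemma derX val v : der val << ucm v >> = val v.
Proof. by rewrite /der /lift evX coefD coefC coefZ coefX mulr1 add0r. Qed.

End DerivationFromValues.

(** * Squarefree parts with bounded coefficients *)

Section SquarefreePart.
Variable F : fieldType.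
Hypothesis char0 : [pchar F] =i pred0.
Implicit Types p d w : {poly F}.

Let natF k : (k.+1%:R : F) != 0.
Proof. by rewrite ((pcharf0P F).1 char0). Qed.

Lemma size_deriv_char0 p : size p^`() = (size p).-1.
Proof.
have [->|p0] := eqVneq p 0; first by rewrite derivC size_poly0.
apply/eqP; rewrite eqn_leq -ltnS (leq_trans (lt_size_deriv p0)) ?leqSpred //=.
case E: (size p) => [|[|s]] //=; apply: contraT; rewrite -leqNgt => /leq_sizeP /(_ s (leqnn s)).
rewrite coef_deriv -mulr_natr => /eqP; rewrite mulf_eq0 (negPf (natF s)) orbF.
have -> : p`_s.+1 = lead_coef p by rewrite lead_coefE E.
by rewrite lead_coef_eq0 (negPf p0).
Qed.

Lemma irreducible_divisor p : (1 < size p)%N -> exists2 d, irreducible_poly d & d %| p.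
Proof.
have [s] := ubnP (size p); elim: s p => // s IH p lts sp.
have [irr|nirr] := pselect (irreducible_poly p); first by exists p.
have [d [sd dp nd]] : exists d, [/\ size d != 1%N, d %| p & ~~ (d %= p)].
  apply: contrapT => H; apply: nirr; split=> // d sd dp.
  by apply: contrapT => /negP nd; apply: H; exists d.
have p0 : p != 0 by rewrite -size_poly_gt0 ltnW.
have d0 : d != 0 by apply: contraNneq p0 => E; rewrite E dvd0p in dp.
have ltd : (size d < size p)%N.
  rewrite ltn_neqAle (dvdp_leq p0 dp) andbT.
  by apply: contra nd; rewrite dvdp_size_eqp.
have [||e irre ed] := IH d; first exact: leq_trans ltd _.
  by have := size_poly_gt0 d; rewrite d0; case: (size d) sd => [|[]].
by exists e => //; apply: dvdp_trans dp.
Qed.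

Lemma irreducible_coprime_deriv d : irreducible_poly d -> coprimep d d^`().
Proof.
move=> [sd irr]; rewrite /coprimep; apply: contraT => /irr /(_ (dvdp_gcdl _ _)).
have d'0 : d^`() != 0 by rewrite -size_poly_gt0 size_deriv_char0 -ltnS prednK // ltnW.
move=> /eqp_size E; have := dvdp_leq d'0 (dvdp_gcdr d d^`()).
by rewrite E size_deriv_char0; case: (size d) sd => // k _; rewrite ltnn.
Qed.

(** Every irreducible divisor [d] of [p] divides [a]: if [d] were coprime to [a], differentiating p
    = g1 a d^k would show that d^(k+1) divides [g] whenever d^k does, against the size of [g].
    Removing irreducible factors one by one then consumes at most [size p] copies of [a]. *)
Lemma dvdp_exp_squarefree_part p : p != 0 ->
  p %| (p %/ gcdp p p^`()) ^+ size p.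
Proof.
move=> p0; set g := gcdp p p^`(); set a := p %/ g.
have gp : g %| p := dvdp_gcdl _ _.
have Ep : p = a * g by rewrite divpK.
have g0 : g != 0 by apply: contraNneq p0 => E; rewrite Ep E mulr0.
have ncop d : irreducible_poly d -> d %| p -> ~~ coprimep d a.
  move=> irr dp; apply/negP => cop; have [sd _] := irr.
  have d0 : d != 0 by rewrite -size_poly_gt0 ltnW.
  suff H k : d ^+ k %| g.
    have := dvdp_leq g0 (H (size g)).
    have : (size g <= (size (d ^+ size g)).-1)%N.
      rewrite size_exp; case: (size d) sd => [|[|e]] //= _.
      by rewrite leq_pmull.
    rewrite -size_poly_gt0 in g0.
    have : (0 < size (d ^+ size g))%N by rewrite size_poly_gt0 expf_neq0.
    by case: (size _) => //= s _ le1 le2; have := leq_trans le2 le1; rewrite ltnn.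
  elim: k => [|k IH]; first by rewrite expr0 dvd1p.
  pose g1 := g %/ d ^+ k; have Eg : g = g1 * d ^+ k by rewrite divpK.
  rewrite Eg exprS dvdp_mul //.
  suff : d %| g1 * a by rewrite Gauss_dvdpl.
  have Epu : p = (g1 * a) * d ^+ k by rewrite Ep [in LHS]Eg mulrA [a * _]mulrC.
  case: k IH g1 Eg Epu => [|k] IH g1 Eg Epu.
    by rewrite expr0 mulr1 in Epu; rewrite -Epu.
  have : d ^+ k.+1 %| p^`() by apply: dvdp_trans IH (dvdp_gcdr _ _).
  rewrite Epu derivM dvdp_addr; last by rewrite dvdp_mull.
  rewrite deriv_exp /= mulrnAr -mulr_natl -polyC_natr mul_polyC dvdpZr ?natF //.
  rewrite exprS mulrA dvdp_mul2r ?expf_neq0 //.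
  by rewrite Gauss_dvdpl // irreducible_coprime_deriv.
suff H w : w %| p -> w %| a ^+ size w by apply: H.
have [s] := ubnP (size w); elim: s w => // s IH w lts wp.
have w0 : w != 0 by apply: contraNneq p0 => E; rewrite E dvd0p in wp.
have [sw|sw] := leqP (size w) 1.
  have : size w == 1%N by rewrite eqn_leq sw size_poly_gt0.
  by rewrite size_poly_eq1 => H; rewrite (eqp_dvdl _ H) dvd1p.
have [d irr dw] := irreducible_divisor sw.
have /ncop := irr => /(_ (dvdp_trans dw wp)); rewrite /coprimep => nc.
have [sd irr'] := irr.
have da : d %| a.
  by have := irr' _ nc (dvdp_gcdl _ _) => /andP[_ /dvdp_trans]; apply; apply: dvdp_gcdr.
pose w1 := w %/ d; have Ew : w = w1 * d by rewrite divpK.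
have w10 : w1 != 0 by apply: contraNneq w0 => E; rewrite Ew E mul0r.
have d0 : d != 0 by rewrite -size_poly_gt0 ltnW.
have sw1 : (size w1 < size w)%N.
  rewrite Ew size_mul //; case: (size d) sd => [|[|k]] // _.
  by rewrite !addnS /= ltnS leq_addr.
have : w1 %| a ^+ size w1.
  apply: IH; first exact: leq_trans sw1 _.
  by apply: dvdp_trans wp; rewrite Ew dvdp_mulr.
move=> H1; rewrite [X in X %| _]Ew; apply: dvdp_trans (dvdp_mul H1 da) _.
by rewrite -exprSr dvdp_exp2l.
Qed.

End SquarefreePart.

Section KernelVector.
Variables (R : comNzRingType) (E : fieldType) (iota : {rmorphism R -> E}).
Hypothesis iota_inj : injective iota.
Variables (a b : nat) (M : 'M[R]_(a, b)).

(* The coordinates of the kernel vector are the maximal minors of a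
   nonvanishing minor of maximal size bordered by one more row. *)
Lemma kernel_vector (v : 'rV[E]_a) : v != 0 -> v *m map_mx iota M = 0 ->
  exists rho (f : 'I_rho.+1 -> 'I_a) (g : 'I_rho -> 'I_b) (w : 'rV[R]_a),
    [/\ (rho < a)%N, w != 0, w *m M = 0 &
      forall i, w 0 i = \sum_(l | f l == i)
        (-1) ^+ (l + 0) * \det (\matrix_(k, j) M (f (lift l k)) (g j))].
Proof.
move=> v0 vM.
pose nzminor r := `[< exists (f : 'I_r -> 'I_a) (g : 'I_r -> 'I_b),
  \det (\matrix_(k, j) M (f k) (g j)) != 0 >].
have inj_f r (f : 'I_r -> 'I_a) (g : 'I_r -> 'I_b) :
    \det (\matrix_(k, j) M (f k) (g j)) != 0 -> injective f.
  move=> dn0 k k' Ek; apply/eqP; apply: contraNT dn0 => ne.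
  by apply/eqP; apply: (determinant_alternate ne) => j; rewrite !mxE Ek.
have bound r : nzminor r -> (r <= a)%N.
  move=> /asboolP[f [g /inj_f If]].
  by have := leq_card _ If; rewrite !card_ord.
have ex0 : exists r, nzminor r.
  exists 0%N; apply/asboolP; exists (fun k : 'I_0 => False_rect _ (notF (ltn_ord k))).
  exists (fun k : 'I_0 => False_rect _ (notF (ltn_ord k))).
  by rewrite det_mx00 oner_neq0.
case: (ex_maxnP ex0 bound) => rho /asboolP[f [g dn0]] max.
have If := inj_f _ _ _ dn0.
(* If the minor used every row, multiplying by its adjugate would force [v = 0]. *)
have [i0 Hi0] : exists i0, i0 \notin codom f.
  apply/existsP; apply: contraT; rewrite negb_exists => /forallP onto.
  have surj i : i \in codom f by have := onto i; rewrite negbK.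
  have bij : bijective f.
    apply: (inj_card_bij If); rewrite -(card_codom If).
    by apply/subset_leq_card/subsetP => i _; apply: surj.
  pose u : 'rV[E]_rho := \row_k v 0 (f k).
  have uM : u *m map_mx iota (\matrix_(k, j) M (f k) (g j)) = 0.
    apply/rowP => j; have /rowP/(_ (g j)) := vM; rewrite !mxE => vMj.
    rewrite -[RHS]vMj [RHS](reindex f) /=; last by apply: onW_bij.
    by apply: eq_bigr => k _; rewrite !mxE.
  have := congr1 (fun X => X *m \adj (map_mx iota (\matrix_(k, j) M (f k) (g j)))) uM.
  rewrite /= -mulmxA mul_mx_adj mul0mx det_map_mx mul_mx_scalar => /eqP.
  rewrite scaler_eq0 (raddf_eq0 _ iota_inj) (negPf dn0) /= => /eqP u0.
  apply: contraNT v0 => _; apply/eqP/rowP => i; rewrite mxE.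
  have [f' _ f'K] := bij; rewrite -(f'K i).
  by have /rowP/(_ (f' i)) := u0; rewrite !mxE.
have lt_rho : (rho < a)%N.
  have If' : injective (fun l : option 'I_rho => if l is Some l' then f l' else i0).
    move=> [l|] [l'|] //= => [/If -> //|Ei|Ei].
      by move: Hi0; rewrite -Ei codom_f.
    by move: Hi0; rewrite Ei codom_f.
  by have := leq_card _ If'; rewrite card_option !card_ord.
pose f' (l : 'I_rho.+1) := if unlift ord0 l is Some l' then f l' else i0.
pose B (j : 'I_b) : 'M[R]_rho.+1 :=
  \matrix_(l, j') M (f' l) (if unlift ord0 j' is Some j'' then g j'' else j).
pose cof (l : 'I_rho.+1) := (-1) ^+ (l + 0) * \det (\matrix_(k, j) M (f' (lift l k)) (g j)).
have cofE j l : cofactor (B j) l ord0 = cof l.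
  rewrite /cofactor /cof; congr (_ * \det _); apply/matrixP => k k'.
  by rewrite !mxE liftK.
(* Bordered minors vanish by maximality of [rho]; their expansion along the first column is the
   relation [w *m M = 0]. *)
have detB j : \det (B j) = 0.
  apply/eqP; apply: contraT => nB; have := max rho.+1; rewrite ltnn; apply.
  apply/asboolP; exists f', (fun j' => if unlift ord0 j' is Some j'' then g j'' else j).
  by apply: contraNN nB => /eqP E0; rewrite -E0.
pose w : 'rV[R]_a := \row_i \sum_(l | f' l == i) cof l.
exists rho, f', g, w; split=> //; last by move=> i; rewrite mxE.
- suff w0 : w 0 i0 != 0 by apply: contraNneq w0 => ->; rewrite mxE.
  rewrite mxE (bigD1 ord0) /=; last by rewrite /f' unlift_none.
  rewrite big1 ?addr0 => [|l /andP[]]; last first.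
    rewrite /f'; case: unliftP => [l' ->|->]; last by rewrite eqxx.
    by move=> /eqP Ei; move: Hi0; rewrite -Ei codom_f.
  rewrite /cof expr0 mul1r.
  suff -> : \matrix_(k, j) M (f' (lift ord0 k)) (g j) = \matrix_(k, j) M (f k) (g j) by [].
  by apply/matrixP => k j; rewrite !mxE /f' liftK.
- apply/rowP => j; rewrite !mxE -[RHS](detB j) (expand_det_col _ ord0).
  under eq_bigr => i _ do rewrite mxE mulr_suml.
  rewrite (exchange_big_dep xpredT) //=; apply: eq_bigr => l _.
  by rewrite (big_pred1 (f' l)) => [|i]; rewrite ?cofE ?mxE ?unlift_none 1?mulrC 1?eq_sym.
Qed.

End KernelVector.

Lemma pseudo_division (R : comNzRingType) (P Q : {poly R}) : (0 < size P)%N ->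
  exists k T S, [/\ (k <= size Q)%N, lead_coef P ^+ k *: Q = T * P + S &
    (size S < size P)%N].
Proof.
move=> sP; have [s] := ubnP (size Q); elim: s Q => // s IH Q lts.
have [ltQ|geQ] := ltnP (size Q) (size P).
  by exists 0%N, 0, Q; rewrite expr0 scale1r mul0r add0r.
pose k := (size Q - size P)%N.
pose Q' := lead_coef P *: Q - lead_coef Q *: ('X^k * P).
have sQ' : (size Q' < size Q)%N := size_pseudo_sub sP geQ.
have [|k' [T [S [lek E sS]]]] := IH Q'; first exact: leq_trans sQ' _.
exists k'.+1, (T + lead_coef P ^+ k' *: (lead_coef Q *: 'X^k)), S; split=> //.
  exact: leq_ltn_trans lek sQ'.
rewrite exprSr -scalerA; have -> : lead_coef P *: Q = Q' + lead_coef Q *: ('X^k * P).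
  by rewrite subrK.
by rewrite scalerDr E mulrDl addrAC -!scalerAl.
Qed.

Lemma rmorph_comb_eq0 (R E : comNzRingType) (pi : {rmorphism R -> E}) x y x' y' :
  pi y = 0 -> pi y' = 0 -> pi (x * y + x' * y') = 0.
Proof. by move=> y0 y'0; rewrite rmorphD !rmorphM y0 y'0 !mulr0 addr0. Qed.

Lemma map_resultant_inj (R : comNzRingType) (E : fieldType) (iota : {rmorphism R -> E})
  (P Q : {poly R}) : injective iota ->
  iota (resultant P Q) = resultant (map_poly iota P) (map_poly iota Q).
Proof.
move=> inj; rewrite /resultant /Sylvester_mx !size_map_inj_poly ?rmorph0 //.
rewrite -det_map_mx /= map_col_mx; congr (\det (col_mx _ _));
  by apply: map_lin1_mx => v; rewrite map_poly_rV rmorphM /= map_rVpoly.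
Qed.

Section SyzygyMatrix.
Variables (R : comNzRingType) (sigma q : nat).
Implicit Types (P : {poly R}) (v : 'rV[R]_(sigma + sigma)).

(** A row vector encodes a pair (h, k) of polynomials of size at most [sigma]; it lies in the left
    kernel when the first [q] coefficients of h P' + k P vanish. Over the fraction field, P and -P'
    divided by their gcd form such a pair. *)
Definition syzygy_mx P : 'M[R]_(sigma + sigma, q) :=
  \matrix_(l, t) (match split l with
                  | inl i => ('X^i * P^`())`_t | inr i => ('X^i * P)`_t end).

Definition lpoly v : {poly R} := \poly_(i < sigma) (if insub i is Some j then v 0 (lshift sigma j) else 0).
Definition rpoly v : {poly R} := \poly_(i < sigma) (if insub i is Some j then v 0 (rshift sigma j) else 0).

Lemma lpolyE v : lpoly v = \sum_(i < sigma) v 0 (lshift sigma i) *: 'X^i.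
Proof. by rewrite /lpoly poly_def; apply: eq_bigr => i _; rewrite valK. Qed.

Lemma rpolyE v : rpoly v = \sum_(i < sigma) v 0 (rshift sigma i) *: 'X^i.
Proof. by rewrite /rpoly poly_def; apply: eq_bigr => i _; rewrite valK. Qed.

Lemma mul_syzygy_mx P v t :
  (v *m syzygy_mx P) 0 t = (lpoly v * P^`() + rpoly v * P)`_t.
Proof.
rewrite mxE big_split_ord /= lpolyE rpolyE coefD !mulr_suml !coef_sum.
congr (_ + _); apply: eq_bigr => i _; rewrite mxE -scalerAl coefZ.
  by rewrite -[lshift sigma i]/(unsplit (inl i)) unsplitK.
by rewrite -[rshift sigma i]/(unsplit (inr i)) unsplitK.
Qed.

End SyzygyMatrix.

Lemma map_syzygy_mx (R E : comNzRingType) (iota : {rmorphism R -> E}) sigma q P :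
  map_mx iota (syzygy_mx sigma q P) = syzygy_mx sigma q (map_poly iota P).
Proof.
apply/matrixP => l t; rewrite !mxE; case: (split l) => i;
  by rewrite !coefXnM ?deriv_map coef_map /=; case: ifP; rewrite ?rmorph0.
Qed.

Section BoundedSquarefreePart.
Variables (K : fieldType) (V : choiceType).
Local Notation R := {malg K[{cmonom V}]}.
Hypothesis char0 : [pchar K] =i pred0.

Lemma pchar0_malg (E : fieldType) (pi : {rmorphism R -> E}) : [pchar E] =i pred0.
Proof.
move=> n; rewrite [RHS]inE; apply/negbTE; have := char0 n; rewrite [RHS]inE => /negbT.
apply: contra => /andP[pn n0]; apply/andP; split=> //.
by move: n0; rewrite -(rmorph_nat (pi \o @malgC {cmonom V} K)) fmorph_eq0.
Qed.

Lemma malg_frac : exists (E : fieldType) (iota : {rmorphism R -> E}), injective iota /\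
  (forall e, exists a b, iota b != 0 /\ e = iota a / iota b).
Proof.
have [|||E [iota [ker fracE]]] := @residue_field R (fun x => x = 0).
- by split=> [|a b -> ->|r a ->]; rewrite ?addr0 ?mulr0.
- by move/eqP; rewrite oner_eq0.
- exact: malg_integral.
exists E, iota; split=> // a b Eab; apply/eqP; rewrite -subr_eq0; apply/eqP/ker.
by rewrite rmorphB Eab subrr.
Qed.

(** Dividing by the gcd leaves h b = - k a with [a] and [b] coprime, so [a] divides [h], and the
    size bound leaves only a constant factor. A small syzygy over the polynomial ring is thus the
    squarefree part up to a scalar. *)
Lemma squarefree_syzygy (E : fieldType) (iota : {rmorphism R -> E}) (P h k : {poly R}) :
  injective iota -> P != 0 -> h != 0 -> h * P^`() + k * P = 0 ->
  let P0 := map_poly iota P in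
  (size h <= size (P0 %/ gcdp P0 P0^`())%R)%N ->
  map_poly iota h %= P0 %/ gcdp P0 P0^`().
Proof.
move=> inj Pn0 hn0 Eq P0 szh; set g := gcdp P0 P0^`(); set a := P0 %/ g.
have P00 : P0 != 0 by rewrite map_poly_eq0_id0 // (raddf_eq0 _ inj) lead_coef_eq0.
have g0 : g != 0 by rewrite gcdp_eq0 (negPf P00).
pose b := P0^`() %/ g; pose h0 := map_poly iota h; pose k0 := map_poly iota k.
have EP : P0 = a * g by rewrite divpK // dvdp_gcdl.
have EP' : P0^`() = b * g by rewrite divpK // dvdp_gcdr.
have Eq0 : h0 * b = - k0 * a.
  apply: (mulIf g0); rewrite -!mulrA -EP -EP'; apply/eqP.
  by rewrite mulNr -addr_eq0 /h0 /k0 /P0 deriv_map -!rmorphM -rmorphD Eq rmorph0.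
have cop : coprimep a b by apply: coprimep_div_gcd; rewrite P00.
have dvd : a %| h0 by rewrite -(Gauss_dvdpl _ cop) Eq0 dvdp_mull.
have h00 : h0 != 0 by rewrite map_poly_eq0_id0 // (raddf_eq0 _ inj) lead_coef_eq0.
have sh : size h0 = size h by rewrite size_map_inj_poly ?rmorph0.
rewrite eqp_sym -(dvdp_size_eqp dvd) eqn_leq (dvdp_leq h00 dvd) /=.
by rewrite sh.
Qed.

(** The resultant of [h] and its derivative is nonzero by coprimality and lies in the variables [T],
    so [pi] does not kill it; as a combination of the two it would vanish at a common root. Constant
    and linear [h] are treated apart because this identity asks for two nonconstant polynomials. *)
Lemma squarefree_nonzero_resultant (E0 E : fieldType) (iota : {rmorphism R -> E0})
    (pi : {rmorphism R -> E}) (T : pred V) (h : {poly R}) xi D :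
  injective iota -> h != 0 -> coprimep (map_poly iota h) (map_poly iota h)^`() ->
  (forall i, bd T D h`_i) -> (forall D' c, bd T D' c -> c != 0 -> pi c != 0) ->
  pi h.[xi] = 0 -> pi (h^`()).[xi] != 0.
Proof.
move=> inj h0 cop bh piT h_xi.
have natR k : (k.+1%:R : R) != 0.
  apply/eqP => /(congr1 iota); rewrite rmorph_nat rmorph0 => /eqP.
  by rewrite ((pcharf0P E0).1 (pchar0_malg iota)).
have lc_pi : pi (lead_coef h) != 0 by apply: piT (bh _) _; rewrite lead_coef_eq0.
case Es : (size h) => [|[|[|s]]].
- by move/eqP: Es; rewrite size_poly_eq0 (negPf h0).
- move: h_xi lc_pi; rewrite lead_coefE Es /= [h in h.[_]]size1_polyC ?Es // hornerC.
  by move=> ->; rewrite eqxx.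
- have -> : h^`() = (lead_coef h)%:P.
    apply/polyP => i; rewrite coef_deriv coefC lead_coefE Es.
    by case: i => [|i] /=; rewrite ?mulr1n // nth_default ?mul0rn // Es.
  by rewrite hornerC.
have sh' : (1 < size h^`())%N.
  rewrite ltnNge; apply/negP => /leq_sizeP /(_ s.+1 isT).
  rewrite coef_deriv -mulr_natr; apply/eqP/malg_mulf_neq0 => //.
  by have -> : h`_s.+2 = lead_coef h; rewrite ?lead_coef_eq0 // lead_coefE Es.
have sh : (1 < size h)%N by rewrite Es.
have [[u v] _ /= Eres] := resultant_in_ideal sh sh'.
have res0 : resultant h h^`() != 0.
  apply/eqP => /(congr1 iota); rewrite map_resultant_inj // rmorph0 -deriv_map => /eqP.
  by rewrite resultant_eq0; move: cop; rewrite /coprimep => /eqP ->.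
have bres : bd T (D * ((size h^`()).-1 + (size h).-1)) (resultant h h^`()).
  apply: bd_det => i j; rewrite Sylvester_mxE.
  case: (split i) => l; apply: bdMn; first exact: bh.
  by rewrite coef_deriv; apply: bdMn.
apply: contraNneq (piT _ _ bres res0) => h'_xi.
have key rs : rs%:P = u * h + v * h^`() -> pi rs = 0.
  move=> /(congr1 (fun Q : {poly R} => Q.[xi])) /=.
  rewrite hornerC hornerD (hornerM u h) (hornerM v) => ->.
  exact: rmorph_comb_eq0 h_xi h'_xi.
by apply/eqP; apply: key Eres.
Qed.

(** The coefficients of [h] are sums of minors of order at most [D.*2.+1] of the syzygy matrix,
    whose entries have degree at most [D]. The factor [r] is the power, at most [(D * D.+1).+1], of
    the leading coefficient of [p] in [z] spent in pseudo-dividing [h ^+ e]. The last clause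
    provides the simple root that implicit differentiation needs. *)
Lemma squarefree_part (T : pred V) z p D : p != 0 -> bd T D p -> (0 < D)%N ->
  exists (h : {poly R}) r e s,
    [/\ (size h <= D.+1)%N /\ (forall i, bd [pred v | T v & v != z] (D * (D.*2.+1)) h`_i),
        r != 0 /\ bd [pred v | T v & v != z] (D * (D * D.+1).+1) r,
        (0 < e <= D.+1)%N, r * h.[<< ucm z >>] ^+ e = s * p &
     forall (E : fieldType) (pi : {rmorphism R -> E}),
       (forall D' c, bd [pred v | T v & v != z] D' c -> c != 0 -> pi c != 0) ->
       pi h.[<< ucm z >>] = 0 -> pi (h^`()).[<< ucm z >>] != 0].
Proof.
move=> pn0 bp D0; set T' := [pred v | T v & v != z].
pose P := tau z p; have bP : bdp T' D P := tau_bdp z bp.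
have Pn0 : P != 0 by rewrite tau_eq0.
have Pz : P.[<< ucm z >>] = p := tauK z p.
have sP := bdp_size bP; have bPc i := bdp_coef i bP.
(* If [z] does not occur in [p], take [h = 1] and [r = p]; the last clause is then vacuous. *)
have [sP1|sP1] := leqP (size P) 1.
  have Ep : p = P`_0 by rewrite -Pz {1}(size1_polyC sP1) hornerC.
  exists 1%:P, p, 1%N, 1; split; rewrite ?hornerC ?expr1 ?mulr1 ?mul1r //.
  - split=> [|i]; first by rewrite size_polyC oner_eq0.
    by rewrite coefC; case: (_ == _); rewrite ?bd1 ?bd0.
  - by split=> //; rewrite Ep; apply: bdW (bPc 0%N); rewrite leq_pmulr.
  - by move=> E pi _; rewrite rmorph1 => /eqP; rewrite oner_eq0.
have [E0 [iota [inj _]]] := malg_frac.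
have char0E := pchar0_malg iota.
pose P0 := map_poly iota P; pose g := gcdp P0 P0^`(); pose a := P0 %/ g.
have P00 : P0 != 0 by rewrite map_poly_eq0_id0 // (raddf_eq0 _ inj) lead_coef_eq0.
have sP0 : size P0 = size P by rewrite size_map_inj_poly ?rmorph0.
have g0 : g != 0 by rewrite gcdp_eq0 (negPf P00).
pose b := P0^`() %/ g.
have EP : P0 = a * g by rewrite divpK // dvdp_gcdl.
have EP' : P0^`() = b * g by rewrite divpK // dvdp_gcdr.
have a0 : a != 0 by apply: contraNneq P00 => E; rewrite EP E mul0r.
pose sigma := size a; pose q := (sigma + size P)%N.
have lesig : (sigma <= size P)%N by rewrite -sP0; apply: leq_divp.
have sb : (size b <= sigma)%N.
  rewrite /sigma /a /b !size_divp // leq_sub2r // size_deriv_char0 //.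
  exact: leq_pred.
pose v : 'rV[E0]_(sigma + sigma) := \row_(l < sigma + sigma) (match split l with
  | inl i => a`_i | inr i => - b`_i end).
have lv : lpoly v = a.
  rewrite -[RHS]coefK lpolyE poly_def; apply: eq_bigr => i _.
  by rewrite mxE -[lshift sigma i]/(unsplit (inl i)) unsplitK.
have rv : rpoly v = - b.
  rewrite rpolyE; apply/polyP => j; rewrite coef_sum coefN.
  under eq_bigr => i _ do rewrite mxE -[rshift sigma i]/(unsplit (inr i)) unsplitK coefZ coefXn mulNr.
  have [ltj|gej] := ltnP j sigma.
    rewrite (bigD1 (Ordinal ltj)) //= eqxx mulr1 big1 ?addr0 // => i ne.
    by rewrite (_ : j == i = false) ?mulr0 ?oppr0 // eq_sym; apply: negbTE.
  rewrite big1 => [|i _]; first by rewrite nth_default ?oppr0 // (leq_trans sb).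
  by rewrite (gtn_eqF (leq_trans (ltn_ord i) gej)) mulr0 oppr0.
have v0 : v != 0.
  apply: contraNneq a0 => E; rewrite -lv E lpolyE big1 // => i _.
  by rewrite mxE scale0r.
have vM : v *m map_mx iota (syzygy_mx sigma q P) = 0.
  rewrite map_syzygy_mx; apply/rowP => t; rewrite mul_syzygy_mx lv rv mxE.
  by rewrite -/P0 EP' EP mulNr mulrCA subrr coef0.
have [rho [f [G [w [ltrho w0 wM bw]]]]] := kernel_vector inj v0 vM.
have bM i j : bd T' D (syzygy_mx sigma q P i j).
  rewrite mxE; case: (split i) => l; rewrite coefXnM; case: ifP; rewrite ?bd0 // => _.
  by rewrite coef_deriv; apply: bdMn.
have bwi i : bd T' (D * D.*2.+1) (w 0 i).
  rewrite bw; apply: bd_sum => l _; rewrite -signr_odd mulr_sign.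
  suff Hd : bd T' (D * D.*2.+1) (\det (\matrix_(k, j) syzygy_mx sigma q P (f (lift l k)) (G j))).
    by case: ifP => _ //; apply: bdN.
  apply: (@bdW _ _ _ (D * rho)); last by apply: bd_det => i' j'; rewrite mxE.
  by rewrite leq_mul2l; apply/orP; right; lia.
pose h := lpoly w; pose k := rpoly w.
have sh : (size h <= sigma)%N := size_poly _ _.
have sk : (size k <= sigma)%N := size_poly _ _.
have Eq : h * P^`() + k * P = 0.
  apply/polyP => t; rewrite coef0; have [ltt|get] := ltnP t q.
    by have /rowP/(_ (Ordinal ltt)) := wM; rewrite mul_syzygy_mx mxE.
  rewrite nth_default //; apply: leq_trans (size_polyD _ _) _.
  rewrite geq_max; apply/andP; split; apply: leq_trans (size_polyMleq _ _) _;
    apply: leq_trans (leq_pred _) _; apply: leq_trans get; apply: leq_add => //.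
  have [->|P'0] := eqVneq P 0; first by rewrite derivC.
  exact/ltnW/lt_size_deriv.
have hn0 : h != 0.
  apply: contraNneq w0 => E; have k0 : k = 0.
    have := congr1 (map_poly iota) Eq; rewrite E mul0r add0r rmorphM rmorph0 => /eqP.
    rewrite mulf_eq0 (negPf P00) orbF => /eqP k00.
    by apply: (map_inj_poly inj (rmorph0 _)); rewrite k00 rmorph0.
  apply/eqP/rowP => i; rewrite mxE -(splitK i); case: (split i) => j /=.
    by have := congr1 (fun Q : {poly R} => Q`_j) E; rewrite coef0 /h coef_poly ltn_ord valK.
  by have := congr1 (fun Q : {poly R} => Q`_j) k0; rewrite coef0 /k coef_poly ltn_ord valK.
have eqh : map_poly iota h %= a := squarefree_syzygy inj Pn0 hn0 Eq sh.
have P_gt0 : (0 < size P)%N by apply: ltnW.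
pose e := size P.
have [k' [Tq [S [lek' E sS]]]] := pseudo_division (h ^+ e) P_gt0.
(* Over the fraction field [P] divides [h ^+ size P], and the remainder is too small to be a nonzero
   multiple of [P]. *)
have S0 : S = 0.
  have Sdvd : P0 %| map_poly iota S.
    have -> : map_poly iota S = map_poly iota (lead_coef P ^+ k' *: h ^+ e) - map_poly iota Tq * P0.
      by rewrite E rmorphD rmorphM /= addrC addKr.
    rewrite dvdp_sub ?dvdp_mull // map_polyZ dvdpZr; last first.
      by rewrite rmorphXn expf_neq0 // (raddf_eq0 _ inj) lead_coef_eq0.
    rewrite rmorphXn (eqp_dvdr _ (eqp_exp e eqh)) /e -sP0.
    exact: dvdp_exp_squarefree_part.
  apply: (map_inj_poly inj (rmorph0 _)); rewrite rmorph0; apply/eqP.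
  apply: contraTT Sdvd => Sn0; rewrite gtNdvdp // sP0 size_map_inj_poly ?rmorph0 //.
exists h, (lead_coef P ^+ k'), e, Tq.[<< ucm z >>]; split.
- split=> [|i]; first by apply: leq_trans sh (leq_trans lesig sP).
  by rewrite /h coef_poly; case: ifP; rewrite ?bd0 //; case: insub; rewrite ?bd0.
- split; first by rewrite malg_expf_neq0 ?lead_coef_eq0.
  apply: bdW (bdXn k' (bPc _)); rewrite leq_mul2l; apply/orP; right.
  apply: leq_trans lek' (leq_trans (size_poly_exp_leq _ _) _).
  by rewrite ltnS leq_mul // -ltnS; case: (size h) sh => [|x] lx; apply: leq_trans (leq_trans lx lesig) _.
- by rewrite /e P_gt0.
- have := congr1 (fun Q : {poly R} => Q.[<< ucm z >>]) E.
  by rewrite S0 addr0 /= hornerZ horner_exp hornerM Pz.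
move=> E1 pi piT; apply: (squarefree_nonzero_resultant inj hn0 _ _ piT) => //.
  have := make_separable P00; rewrite -(eqp_separable eqh).
  by rewrite unlock.
by move=> i; rewrite /h coef_poly; case: ifP; rewrite ?bd0 //; case: insub; rewrite ?bd0.
Qed.

End BoundedSquarefreePart.

(** * Differential consequences of the system *)

Section DerivationPowers.
Variables (R : comNzRingType) (D : R -> R).
Hypothesis DP : derivation_over (idfun : {rmorphism R -> R}) D.

Lemma der_exp a k : D (a ^+ k.+1) = k.+1%:R * a ^+ k * D a.
Proof.
elim: k => [|k IH]; first by rewrite expr0 expr1 mulr1 mul1r.
rewrite exprS (derM DP) IH /= -[k.+2]addn1 natrD !exprS; ring.
Qed.

(* Ritt's argument that [h ^+ e] has [(D h) ^+ (2 * e - 1)] in its differential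
   ideal, keeping track of the number of derivations. *)
Lemma derivative_power (J : nat -> R -> Prop) r h e :
  (forall k, ideal (J k)) -> (forall k a, J k a -> J k.+1 a) ->
  (forall k a, J k a -> J k.+1 (D a)) ->
  (forall k i a, J k (i.+1%:R * a) -> J k a) ->
  J 0 (r * h ^+ e.+1) -> J e.+1 (r ^+ e.+2 * D h ^+ (e.*2).+1).
Proof.
move=> idJ incJ DJ natJ J0.
(* Each further derivation trades one factor [h] for two factors [D h], at the cost of one more
   [r]. *)
suff H l k : (l + k = e)%N -> J k.+1 (r ^+ k.+2 * h ^+ l * D h ^+ (k.*2).+1).
  by have := H 0%N e (add0n e); rewrite expr0 mulr1.
elim: k l => [|k IH] l E.
  rewrite addn0 in E; apply: (natJ _ e).
  have -> : e.+1%:R * (r ^+ 2 * h ^+ l * D h ^+ 0.*2.+1) =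
      r * D (r * h ^+ e.+1) - D r * (r * h ^+ e.+1).
    by rewrite (derM DP) der_exp E /= expr1 exprS; ring.
  by apply: (idealB (idJ _)); apply: (idealM (idJ _)); [apply: DJ|apply: incJ].
set X := r ^+ k.+2 * h ^+ l.+1 * D h ^+ (k.*2).+1.
have JX : J k.+1 X by apply: IH; rewrite -E addSnnS.
apply: (natJ _ l).
have -> : l.+1%:R * (r ^+ k.+3 * h ^+ l * D h ^+ (k.+1.*2).+1) =
    r * D h * D X - (k.+2%:R * D r * D h + (k.*2).+1%:R * r * D (D h)) * X.
  rewrite /X (derM DP (r ^+ _ * _)) (derM DP (r ^+ _)) !der_exp /= doubleS !exprS.
  ring.
by apply: (idealB (idJ _)); apply: (idealM (idJ _)); [apply: DJ|apply: incJ].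
Qed.

End DerivationPowers.

Section DifferentialPolynomials.
Variables (K : fieldType) (n m : nat).
Local Notation V := (dvar n m).
Local Notation R := {malg K[{cmonom V}]}.
Implicit Types (h : R) (v w : V) (mo : {cmonom V}).

Lemma dder_monEw mo (d : {fset V}) : (finsupp mo `<=` d)%fset ->
  dder_mon K mo = \sum_(v <- d)
     (mo v)%:R *: << mulcm (divcm mo (ucm v)) (ucm (shiftv v)) >> :> R.
Proof.
move=> le; rewrite /dder_mon (big_fset_incl _ le) // => v _.
by rewrite -cmE_eq0 => /eqP ->; rewrite scale0r.
Qed.

Lemma dder_mon_mul w mo : dder_mon K (mulcm (ucm w) mo) =
  << ucm (shiftv w) >> * << mo >> + << ucm w >> * dder_mon K mo :> R.
Proof.
have mulU (m1 m2 : {cmonom V}) : << m1 >> * << m2 >> = << mulcm m1 m2 >> :> R.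
  by rewrite malgM_def fgmulUU mulr1.
pose d := (finsupp (mulcm (ucm w) mo) `|` finsupp mo)%fset.
rewrite (dder_monEw (d := d) (fsubsetUl _ _)) (dder_monEw (d := d) (fsubsetUr _ _)).
have wd : w \in d.
  by rewrite in_fsetU -!cmE_neq0 mulcmE ucmE eqxx.
(* The exponents of the product exceed those of [mo] by one at [w] only: the extra unit gives the
   term with [shiftv w], the other exponents give [w] times the derivative of [mo]. *)
have split_coef v (x : R) : (mulcm (ucm w) mo v)%:R *: x = (w == v)%:R *: x + (mo v)%:R *: x.
  by rewrite mulcmE ucmE natrD scalerDl.
pose t v : R := << mulcm (divcm (mulcm (ucm w) mo) (ucm v)) (ucm (shiftv v)) >>.
transitivity (\sum_(v <- d) ((w == v)%:R *: t v + (mo v)%:R *: t v)).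
  by apply: eq_bigr => v _; apply: split_coef.
rewrite big_split /=; apply: (congr2 (@GRing.add R)).
  rewrite (big_fsetD1 w) //= eqxx scale1r big1_fset => [|v]; last first.
    by rewrite !inE eq_sym => /andP[/negPf -> _] _; rewrite scale0r.
  have Ed : divcm (mulcm (ucm w) mo) (ucm w) = mo.
    by apply/eqP/cmP => v; rewrite divcmE mulcmE addKn.
  rewrite addr0 /t Ed; rewrite (mulcmC mo).
  exact: esym (mulU _ _).
rewrite mulr_sumr; apply: eq_bigr => v _.
have scale0_eq (c : K) (x y z : R) : c = 0 -> c *: x = y * (c *: z).
  by move=> ->; rewrite 2!scale0r mulr0.
have [mv0|mv] := posnP (mo v); first by apply: scale0_eq; rewrite mv0.
apply: etrans (scalerAr _ _ _); apply: (congr1 (fun x : R => (mo v)%:R *: x)).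
apply: etrans (esym (mulU _ _)); apply: (congr1 (fun M => << M >> : R)).
apply/eqP/cmP => u; rewrite [LHS]mulcmE divcmE mulcmE [RHS]mulcmE [in RHS]mulcmE divcmE.
rewrite addnA addnBA //.
by rewrite ucmE; case: eqP => // <-.
Qed.

(** Both sides obey the Leibniz rule on monomials ([dder_mon_mul] on the left) and agree on
    variables. The general Leibniz rule for [dder] is inherited from the right-hand side. *)
Lemma dderE h : dder h = der (idfun : {rmorphism R -> R}) (fun v => << ucm (shiftv v) >>) h.
Proof.
pose D := der (idfun : {rmorphism R -> R}) (fun v : V => << ucm (shiftv v) >>).
have DP : derivation_over (idfun : {rmorphism R -> R}) D := der_derivation _ _.
change (dder h = D h); rewrite {2}(monalgE h) (der_sum DP) /dder.
apply: eq_bigr => mo _.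
have -> : << h@_mo *g mo >> = (h@_mo)%:MP * << mo >> :> R.
  by rewrite malgM_def fgmulUU mulr1 mul1m.
have DZ c (x : R) : D (c%:MP * x) = c *: D x.
  have Dc : D c%:MP = 0 by apply: derC.
  by rewrite (derM DP) Dc mul0r add0r mul_malgC.
apply: etrans (esym (DZ _ _)); apply: (congr1 (fun x : R => h@_mo *: x)).
elim: (mdeg mo) {-2}mo (erefl (mdeg mo)) => [|k IH] {}mo.
  move=> /mdeg_eq0I ->; rewrite /dder_mon mdom1 big_seq_fset0.
  by rewrite -[LHS](derC (idfun : {rmorphism R -> R}) (fun v : V => << ucm (shiftv v) >>) 1).
move=> Emo; have [v vmo] : exists v, v \in finsupp mo.
  apply/fset0Pn; apply: contra_eqN Emo => /eqP E.
  by rewrite mdegE E big_seq_fset0.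
have Eq := monomE vmo; have := mdegM (ucm v) (divcm mo (ucm v)).
rewrite mdegU -[X in mdeg X]Eq Emo => -[Ek].
have EM : << mo >> = << ucm v >> * << divcm mo (ucm v) >> :> R.
  by rewrite {1}Eq malgM_def fgmulUU mulr1.
have Dv : D << ucm v >> = << ucm (shiftv v) >> by apply: derX.
have -> : D << mo >> = << ucm (shiftv v) >> * << divcm mo (ucm v) >>
    + << ucm v >> * D << divcm mo (ucm v) >>.
  by rewrite -Dv; apply: etrans (derM DP _ _); apply: congr1.
have <- : dder_mon K (divcm mo (ucm v)) = D << divcm mo (ucm v) >>.
  by apply: IH; rewrite [RHS]Ek.
by apply: etrans (dder_mon_mul _ _); apply: congr1.
Qed.

Lemma dder_derivation : derivation_over (idfun : {rmorphism R -> R}) (@dder K n m).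
Proof.
have [DD DM] := der_derivation (idfun : {rmorphism R -> R}) (fun v : V => << ucm (shiftv v) >>).
by split=> a b; rewrite !dderE; [apply: DD|apply: DM].
Qed.

Lemma dderC c : dder (c%:MP : R) = 0.
Proof. by rewrite dderE derC. Qed.

Lemma dderX v : dder (<< ucm v >> : R) = << ucm (shiftv v) >>.
Proof. by rewrite dderE derX. Qed.

Lemma dder_bd (T T' : pred V) D h : {subset T <= T'} ->
  (forall v, T v -> T' (shiftv v)) -> bd T D h -> bd T' D (dder h).
Proof.
move=> sT sT' bh; suff [] : bd T' D h /\ bd T' D (dder h) by [].
move: D h bh; apply: bd_ind => [c|v Tv|D a b [Ha Ha'] [Hb Hb']|D D' a b [Ha Ha'] [Hb Hb']|D D' a le [Ha Ha']].
- by rewrite dderC bd0; split=> //; apply: bdC.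
- by rewrite dderX; split; apply: bdX; [apply: sT|apply: sT'].
- by rewrite (derD dder_derivation); split; apply: bdD.
- rewrite (derM dder_derivation); split; first exact: bdM.
  by apply: bdD; apply: bdM.
- by split; apply: bdW le _.
Qed.

End DifferentialPolynomials.

Lemma ev_bd (K : fieldType) (V V' : choiceType) (T : pred V) (T' : pred V')
    (val : V -> {malg K[{cmonom V'}]}) D d h :
  (forall v, T v -> bd T' d (val v)) -> bd T D h ->
  bd T' (D * d) (ev (@malgC {cmonom V'} K) val h).
Proof.
move=> Hval; move: D h; apply: bd_ind => [c|v Tv|D a b Ha Hb|D D' a b Ha Hb|D D' a le Ha].
- by rewrite evC bdC.
- by rewrite evX mul1n; apply: Hval.
- by rewrite rmorphD; apply: bdD.
- by rewrite rmorphM mulnDl; apply: bdM.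
- by apply: bdW Ha; rewrite leq_mul2r le orbT.
Qed.

(** * Zeros of the differential ideal in a field *)

Section System.
Variables (K : fieldType) (n m s : nat).
Local Notation V := (dvar n m).
Local Notation R := {malg K[{cmonom V}]}.
Variables (f : 'I_n -> R) (g : 'I_s -> R).
Implicit Types (h : R) (v z : V).

Definition order0 : pred V := fun v => v.2 == 0%N.
Definition state0 : pred V := fun v => (v.2 == 0%N) && (if v.1 is inl _ then true else false).

Lemma bd_vars_in (T : pred V) D h :
  vars_in T (h : dpoly K n m) -> (tdeg (h : dpoly K n m) <= D)%N -> bd T D h.
Proof.
move=> HT Hd; apply/bdP => mo mo_h; split.
  by apply: leq_trans Hd; apply: leq_bigmax_seq.
by move=> v v_mo; apply: HT; apply/hasP; exists mo.
Qed.

(** Applied to the derivative of a polynomial in order-zero states, this returns to order zero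
    without changing the class modulo x' - f. *)
Definition state_subst : R -> R :=
  ev (@malgC {cmonom V} K)
     (fun v => if v is (inl j, 1%N) then f j else << ucm v >>).
HB.instance Definition _ := GRing.RMorphism.on state_subst.

Lemma state_substC c : state_subst c%:MP = c%:MP.
Proof. exact: evC. Qed.

Lemma state_substX v : state_subst << ucm v >> =
  if v is (inl j, 1%N) then f j else << ucm v >>.
Proof. exact: evX. Qed.

Lemma state_substD a b : state_subst (a + b) = state_subst a + state_subst b.
Proof. exact: evD. Qed.

Lemma state_substM a b : state_subst (a * b) = state_subst a * state_subst b.
Proof. exact: evM. Qed.

Section DifferentialZero.
Variables (E : fieldType) (pi : {rmorphism R -> E}) (zs : seq V) (H : V -> {poly R}).
Hypothesis fracE : forall e : E, exists a b, pi b != 0 /\ e = pi a / pi b.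
Hypothesis pi_g : forall k, pi (g k) = 0.
Hypothesis f0 : forall j, exists D, bd order0 D (f j).
Hypothesis g0 : forall k, exists D, bd order0 D (g k).
Hypothesis pi_inj : forall D c, bd [pred v | v \notin zs] D c -> c != 0 -> pi c != 0.
Hypothesis coefH : forall z i, z \in zs -> exists D, bd [pred v | v \notin zs] D (H z)`_i.
Hypothesis pi_H : forall z, z \in zs -> pi (H z).[<< ucm z >>] = 0.
Hypothesis pi_H' : forall z, z \in zs -> pi ((H z)^`()).[<< ucm z >>] != 0.
Hypothesis stateH : forall j p, (inl j, p) \in zs ->
  (exists D, bd state0 D (H (inl j, p)).[<< ucm (inl j, p) >>]) /\
  pi (state_subst (dder (H (inl j, p)).[<< ucm (inl j, p) >>])) = 0.

Let val0 v : E := if v is (inl j, 0%N) then pi (f j) else 0.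
Let d0 := der pi val0.
(** Implicit differentiation: [d0] holds all inputs constant, and the value given to an input of
    [zs] cancels what [d0] leaves of its relation. Inputs outside [zs] remain constants. *)
Let val v : E := if v is (inr k, p) then
    (if v \in zs then - d0 (H v).[<< ucm v >>] / pi ((H v)^`()).[<< ucm v >>] else 0)
  else val0 v.
Let d := der pi val.

Let d0P : derivation_over pi d0. Proof. exact: der_derivation. Qed.
Let dP : derivation_over pi d. Proof. exact: der_derivation. Qed.

Let d_state D h : bd state0 D h -> d h = pi (state_subst (dder h)).
Proof.
move=> bh; suff [] : state_subst h = h /\ d h = pi (state_subst (dder h)) by [].
move: D h bh; apply: bd_indT => [c|v sv|a b [Ha Ha'] [Hb Hb']|a b [Ha Ha'] [Hb Hb']].
- rewrite state_substC /d derC dderC; split=> //.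
  by rewrite -[0 in RHS]malgC0E state_substC malgC0E rmorph0.
- rewrite state_substX dderX state_substX /d derX.
  by case: v sv => [[j|k] [|p]].
- by rewrite (derD dP) (derD (@dder_derivation K n m)) 2!state_substD Ha Hb Ha' Hb' rmorphD.
- have [Hab mixed] := rmorph_leibniz (sg := state_subst : {rmorphism R -> R}) pi (dder a) (dder b) Ha Hb.
  split; first exact: Hab.
  rewrite (derM dP) Ha' Hb' (derM (@dder_derivation K n m)).
  exact: esym mixed.
Qed.

(** For a state this is the vanishing of w_z, transported by [d_state]. For an input, [d] and [d0]
    agree on the coefficients of [H z], and the chain rule meets the choice of [val]. *)
Let d_H z : z \in zs -> d (H z).[<< ucm z >>] = 0.
Proof.
case: z => [[j|k] p] zin.
  by have [[D bH] Eq] := stateH zin; rewrite (d_state bH).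
set z : V := (inr k, p); pose Q := H z.
have ddP := derivation_sub dP d0P.
have coef0 i : d Q`_i - d0 Q`_i = 0.
  have [D b] := coefH i zin; apply/eqP; rewrite subr_eq0; apply/eqP.
  apply: (derivation_eq_on dP d0P _ _ b) => [c|v vz]; first by rewrite /d /d0 !derC.
  rewrite /d /d0 !derX; case: v vz => [[j|k'] p'] //= /negPf vz.
  by rewrite /val vz /val0.
have := der_horner ddP << ucm z >> coef0.
have -> : d << ucm z >> - d0 << ucm z >> =
    - d0 Q.[<< ucm z >>] / pi (Q^`()).[<< ucm z >>].
  by rewrite /d [X in _ - X]derX derX /val zin /= subr0.
rewrite mulrC divfK; last exact: pi_H'.
by move=> /eqP; rewrite subr_eq addNr => /eqP.
Qed.

(** The variables of [zs] are adjoined one at a time with [kill_adjoin], starting from the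
    polynomials free of [zs], on which [pi] is injective. *)
Let d_ker a : pi a = 0 -> d a = 0.
Proof.
suff HA (r : seq V) : {subset r <= zs} -> forall D b,
    bd [pred v | (v \notin zs) || (v \in r)] D b -> pi b = 0 -> d b = 0.
  have [D ba] := bd_total a; apply: (HA zs) => //; apply: (bd_sub _ (leqnn D) ba).
  by move=> v _; rewrite !inE orNb.
elim: r => [|z r IH] sub D b bb pb.
  have [->|b0] := eqVneq b 0; first exact: der0 dP.
  have bb' : bd [pred v | v \notin zs] D b.
    by apply: (bd_sub _ (leqnn D) bb) => v; rewrite !inE orbF.
  by have := pi_inj bb' b0; rewrite pb eqxx.
have zin : z \in zs by apply: sub; rewrite inE eqxx.
have sub' : {subset r <= zs} by move=> v vr; apply: sub; rewrite inE vr orbT.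
pose T := [pred v | (v \notin zs) || (v \in r)].
pose A (c : R) := exists D', bd T D' c.
have merge (x y : R) : A x -> A y -> exists D', bd T D' x /\ bd T D' y.
  move=> [D1 b1] [D2 b2]; exists (maxn D1 D2).
  by split; [apply: bdW b1; rewrite leq_maxl|apply: bdW b2; rewrite leq_maxr].
rewrite -(tauK z b); apply: (@kill_adjoin _ _ pi d A << ucm z >> dP _ _ _ _ (H z)).
- by move=> x y Ax Ay; have [D' [bx by_]] := merge _ _ Ax Ay; exists D'; apply: bdB.
- by exists 0%N; apply: bd0.
- by move=> x y [D1 b1] [D2 b2]; exists (D1 + D2)%N; apply: bdM.
- by move=> x [D' bx]; apply: IH bx.
- move=> i; have [D' bi] := coefH i zin; exists D'.
  by apply: (bd_sub _ (leqnn D') bi) => v; rewrite !inE => ->.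
- exact: pi_H.
- exact: d_H.
- exact: pi_H'.
- move=> i; exists D; apply: (bd_sub _ (leqnn D) (bdp_coef i (tau_bdp z bb))) => v.
  by rewrite !inE => /andP[+ /negPf vz]; rewrite vz.
- by rewrite tauK.
Qed.

(** The morphism [psi] sends the p-th derivative of a variable to [iter p dE] of its image under
    [pi]. It commutes with the derivations and agrees with [pi] at order zero, so its kernel is a
    differential ideal containing the generators but not 1. *)
Lemma differential_zero : ~ diff_ideal_gen (lhs_gens f g) 1.
Proof.
move=> H1; have [dE [dED dEM dEpi]] := derivation_frac dP d_ker fracE.
pose psi : {rmorphism R -> E} :=
  ev (pi \o @malgC {cmonom V} K) (fun v => iter v.2 dE (pi << ucm (v.1, 0%N) >>)).
have psiC c : psi c%:MP = pi c%:MP by apply: evC.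
have psiX v : psi << ucm v >> = iter v.2 dE (pi << ucm (v.1, 0%N) >>) by apply: evX.
have psi_ord0 D h : bd order0 D h -> psi h = pi h.
  apply: rmorph_eq_on => // -[w p] /eqP /= p0.
  by rewrite psiX /= p0.
have psi_der h : psi (dder h) = dE (psi h).
  have [D bh] := bd_total h.
  have P1 := derivation_comp psi (@dder_derivation K n m).
  have P2 := derivation_precomp psi (conj dED dEM : derivation_over (idfun : {rmorphism E -> E}) dE).
  apply: (derivation_eq_on P1 P2 _ _ bh) => [c|v _].
    have -> : dder (c%:MP : R) = 0 := dderC _ _ c.
    by rewrite rmorph0 psiC dEpi; apply/esym/derC.
  have -> : dder (<< ucm v >> : R) = << ucm (shiftv v) >> := dderX _ v.
  by apply: etrans (psiX (shiftv v)) _; apply/esym/(congr1 dE (psiX v)).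
have : psi 1 = 0.
  apply: (H1 (fun r => psi r = 0)).
    split; last by move=> a Ea; rewrite psi_der Ea -(rmorph0 pi) dEpi (der0 dP) rmorph0.
    split=> [|a b Ea Eb|r a Ea]; first exact: rmorph0.
      by apply: etrans (rmorphD psi a b) _; rewrite Ea Eb addr0.
    by apply: etrans (rmorphM psi r a) _; rewrite Ea mulr0.
  move=> h; rewrite mem_cat => /orP[] /mapP[j _ ->].
    have [D bf] := f0 j.
    rewrite rmorphB (psi_ord0 _ _ bf) psiX /= dEpi /d derX /val /val0.
    by rewrite subrr.
  have [D bg] := g0 j.
  by rewrite (psi_ord0 _ _ bg) pi_g.
by rewrite rmorph1; apply/eqP; rewrite oner_eq0.
Qed.

End DifferentialZero.
End System.

Arguments order0 {n m}.
Arguments state0 {n m}.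

Lemma ideal_subX (R : comNzRingType) (J : R -> Prop) a b k :
  ideal J -> J (a - b) -> J (a ^+ k - b ^+ k).
Proof.
move=> idJ Jab; elim: k => [|k IH]; first by rewrite subrr; apply: ideal0.
have -> : a ^+ k.+1 - b ^+ k.+1 = a * (a ^+ k - b ^+ k) + b ^+ k * (a - b).
  by rewrite !exprSr !mulrBr [a * _]mulrC [a * _]mulrC addrA subrK.
by apply: (idealD idJ); apply: (idealM idJ).
Qed.

(** [Q] is replaced by its derivative as long as that vanishes at [xi]. This stops: in
    characteristic zero only constants have derivative zero, and [pi] kills no nonzero one. It
    serves the inputs, whose relations yield no new generator, so that plain differentiation can
    replace the bounded squarefree part. *)
Lemma separating_derivative (K : fieldType) (V : choiceType) (E : fieldType)
    (pi : {rmorphism {malg K[{cmonom V}]} -> E}) (T : pred V) D xi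
    (Q : {poly {malg K[{cmonom V}]}}) :
  [pchar K] =i pred0 -> Q != 0 -> (forall i, bd T D Q`_i) ->
  (forall c, bd T D c -> c != 0 -> pi c != 0) -> pi Q.[xi] = 0 ->
  exists H : {poly {malg K[{cmonom V}]}},
    [/\ forall i, bd T D H`_i, pi H.[xi] = 0 & pi (H^`()).[xi] != 0].
Proof.
move=> char0; have [k] := ubnP (size Q); elim: k Q => // k IH Q lts Q0 bQ piT Qxi.
have [Q'xi|] := eqVneq (pi (Q^`()).[xi]) 0; last by exists Q.
apply: (IH Q^`()) => //.
- by apply: leq_trans (lt_size_deriv Q0) _.
- apply/eqP => dQ0.
  have Qi i : Q`_i.+1 = 0.
    have := congr1 (fun S : {poly {malg K[{cmonom V}]}} => S`_i) dQ0.
    rewrite coef_deriv coef0 -scaler_nat => /eqP; rewrite scaler_eq0 => /orP[].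
      by move=> i0; have := (pcharf0P K).1 char0 i.+1; rewrite i0.
    by move/eqP.
  have EQ : Q = (Q`_0)%:P by apply/polyP => -[|i]; rewrite coefC.
  have : pi Q`_0 != 0.
    by apply: piT => //; apply: contraNneq Q0 => c0; rewrite EQ c0.
  by rewrite EQ hornerC in Qxi; rewrite Qxi eqxx.
- by move=> i; rewrite coef_deriv; apply: bdMn.
Qed.

Lemma elim_bound_ge k D : (0 < D)%N -> (D <= elim_bound k D)%N.
Proof.
elim: k D => [|k IH] D D0 //; rewrite /elim_bound iterSr.
have le : (D <= 2 * (D * D))%N by rewrite mulnA leq_pmull // muln_gt0 D0.
exact: leq_trans le (IH _ (leq_trans D0 le)).
Qed.

Lemma elim_bound_mono k k' D D' : (0 < D)%N -> (k <= k')%N -> (D <= D')%N ->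
  (elim_bound k D <= elim_bound k' D')%N.
Proof.
move=> D0; elim: k k' D D' D0 => [|k IH] k' D D' D0 lek leD.
  exact: leq_trans leD (elim_bound_ge _ (leq_trans D0 leD)).
case: k' lek => // k' lek; rewrite /elim_bound !iterSr; apply: IH => //.
  by rewrite muln_gt0 /= muln_gt0 D0.
by rewrite leq_mul2l /= leq_mul.
Qed.

Lemma rmorph_factor_eq0 (R : comNzRingType) (E : fieldType) (pi : {rmorphism R -> E})
  r k y l : pi r != 0 -> pi (r ^+ k * y ^+ l) = 0 -> pi y = 0.
Proof.
move=> r0; rewrite rmorphM !rmorphXn => /eqP.
by rewrite mulf_eq0 !expf_eq0 (negPf r0) andbF /= => /andP[_ /eqP].
Qed.

Lemma rmorph_mul_eq0 (R E : comNzRingType) (pi : {rmorphism R -> E}) x y :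
  pi y = 0 -> pi (x * y) = 0.
Proof. by move=> y0; rewrite rmorphM y0 mulr0. Qed.

(** * One elimination step *)

Section Step.
Variables (K : fieldType) (n m s : nat).
Hypothesis char0 : [pchar K] =i pred0.
Local Notation V := (dvar n m).
Local Notation R := {malg K[{cmonom V}]}.
Variables (f : 'I_n -> R) (g : 'I_s -> R) (d : nat).
Hypothesis d_gt0 : (0 < d)%N.
Hypothesis bf : forall j, bd order0 d (f j).
Hypothesis bg : forall k, bd order0 d (g k).
Implicit Types (h : R) (v z : V).

(** Cofactors range over all differential polynomials; [idl_poly_ideal_gen] later moves them into
    the finitely many variables that occur. *)
Definition prolonged L : R -> Prop :=
  idl (fun h => (h : dpoly K n m) \in rhs_gens L f g).

Lemma mem_rhs_gens L h : (h : dpoly K n m) \in rhs_gens L f g <->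
  (exists i j, (i <= L)%N /\ h = << ucm (inl j, i.+1) >> - dderN i (f j)) \/
  (exists i k, (i <= L)%N /\ h = dderN i (g k)).
Proof.
rewrite mem_cat; split=> [/orP[] /allpairsP[p [Hi _ ->]]|].
- by left; exists p.1, p.2; split=> //; move: Hi; rewrite mem_iota add0n ltnS.
- by right; exists p.1, p.2; split=> //; move: Hi; rewrite mem_iota add0n ltnS.
case=> [[i [j [lei ->]]]|[i [k [lei ->]]]]; apply/orP; [left|right];
  apply/allpairsP; [exists (i, j)|exists (i, k)];
  by split; rewrite ?mem_iota ?mem_enum.
Qed.

Lemma prolongedS L L' h : (L <= L')%N -> prolonged L h -> prolonged L' h.
Proof.
move=> le; apply: idl_sub => w /mem_rhs_gens[[i [j [lei Ew]]]|[i [k [lei Ew]]]];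
  apply/idl_gen/mem_rhs_gens; [left; exists i, j|right; exists i, k];
  by split=> //; apply: leq_trans le.
Qed.

Lemma prolonged_dder L h : prolonged L h -> prolonged L.+1 (dder h).
Proof.
have [DD DM] := @dder_derivation K n m.
have le := prolongedS (leqnSn L).
elim=> [|x y Hx Dx Hy Dy|a x Hx Dx|w /mem_rhs_gens Hw].
- by rewrite (der0 (@dder_derivation K n m)); apply: idl0.
- rewrite DD; exact: idlD Dx Dy.
- rewrite DM; exact: idlD (idlM _ (le _ Hx)) (idlM _ Dx).
apply/idl_gen/mem_rhs_gens; case: Hw => [[i [j [lei ->]]]|[i [k [lei ->]]]].
  left; exists i.+1, j; split=> //.
  by rewrite (derB (@dder_derivation K n m)) dderX.
by right; exists i.+1, k.
Qed.

Lemma prolonged_nat L i h : prolonged L (i.+1%:R * h) -> prolonged L h.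
Proof.
have i0 : (i.+1%:R : K) != 0 by rewrite ((pcharf0P K).1 char0).
move=> /(idlM (i.+1%:R^-1)%:MP); rewrite mulrA -mpolyC_nat -mpolyCM mulVf //.
by rewrite mpolyC1E mul1r.
Qed.

Let subst_mul (R' : comNzRingType) (x y a b : R') :
  x * y - a * b = x * (y - b) + b * (x - a).
Proof. by rewrite !mulrBr [b * x]mulrC [b * a]mulrC addrA subrK. Qed.

Lemma prolonged_subst h : prolonged 0 (state_subst f h - h).
Proof.
have [D bh] := bd_total h.
move: D h bh; apply: bd_indT => [c|v _|a b Ha Hb|a b Ha Hb].
- by rewrite state_substC subrr; apply: idl0.
- rewrite state_substX; case: v => [[j|k] [|[|p]]]; rewrite ?subrr; try exact: idl0.
  rewrite -opprB; apply: (idealN (idl_ideal _)); apply/idl_gen/mem_rhs_gens.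
  by left; exists 0%N, j.
- rewrite state_substD opprD addrACA; exact: idlD Ha Hb.
- have -> : state_subst f (a * b) - a * b =
      state_subst f a * (state_subst f b - b) + b * (state_subst f a - a).
    by rewrite state_substM; apply: subst_mul.
  exact: idlD (idlM _ Hb) (idlM _ Ha).
Qed.

(** The first summand stems from [r ^+ e.+2], the second from the power [e.*2.+1] of the derivative
    of [h] after inserting [f], of degree at most [D]. They are at most 9 D^4 and 12 D^4. *)
Lemma omega_bound D e : (0 < D)%N -> (e <= D)%N ->
  (D * (D * D.+1).+1 * e.+2 + (D * D.*2.+1 + D) * D * e.*2.+1 <= 21 * D ^ 4)%N.
Proof.
move=> D0 le; have -> : (21 * D ^ 4 = D * (3 * (D * D)) * (3 * D) + (4 * (D * D)) * D * (3 * D))%N.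
  by rewrite !expnS expn0; nia.
by apply: leq_add; apply: leq_mul; try apply: leq_mul; nia.
Qed.

(** Since [T] consists of states, the derivative of h(z) involves states of order at most one, and
    substitution brings it to order zero. The [D.+1] extra derivations are those of
    [derivative_power] for an exponent at most [D.+1]. As [pi] does not kill [r], the vanishing of
    [w] passes to the substituted derivative. *)
Lemma state_consequence D z p : (d <= D)%N -> state0 z -> forall T : pred V,
  {subset T <= state0} -> T z -> p != 0 -> bd T D p -> prolonged D p ->
  exists (h : {poly R}) w,
    [/\ (forall i, exists D', bd [pred v | T v & v != z] D' h`_i)
        /\ (exists D', bd T D' h.[<< ucm z >>]),
      bd order0 (21 * D ^ 4) w, prolonged (D + D.+1) w &
      forall (E : fieldType) (pi : {rmorphism R -> E}),
        (forall D' c, bd [pred v | T v & v != z] D' c -> c != 0 -> pi c != 0) ->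
        pi p = 0 -> pi w = 0 ->
        [/\ pi h.[<< ucm z >>] = 0, pi (h^`()).[<< ucm z >>] != 0 &
            pi (state_subst f (dder h.[<< ucm z >>])) = 0]].
Proof.
move=> dD z0 T sT Tz p0 bp idp.
have D0 : (0 < D)%N := leq_trans d_gt0 dD.
have [h [r [e1 [s' [[szh bh] [r0 br] /andP[e1_gt0 lee1] Eq1 Hpi]]]]] :=
  squarefree_part char0 z p0 bp D0.
case: e1 e1_gt0 lee1 Eq1 => [|e] e_gt0 lee Eq; first by rewrite ltnn in e_gt0.
pose y := h.[<< ucm z >>]; pose w := r ^+ e.+2 * state_subst f (dder y) ^+ (e.*2).+1.
have sT' : {subset [pred v | T v & v != z] <= T} by move=> v /andP[].
have by_ : bd T (D * D.*2.+1 + D) y.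
  apply: bdW (tau_horner_bd (fun i => bd_sub sT' (leqnn _) (bh i)) Tz).
  by rewrite leq_add2l; case: (size h) szh.
have bw : bd order0 (21 * D ^ 4) w.
  apply: bdW (omega_bound D0 lee) _; apply: bdM; apply: bdXn.
    apply: (bd_sub _ (leqnn _) br) => v /sT' /sT /andP[v0 _]; exact: v0.
  pose T1 : pred V := fun v => if v.1 is inl _ then (v.2 <= 1)%N else false.
  apply: (@ev_bd _ _ _ T1 order0 _ (D * D.*2.+1 + D) D).
    move=> [[j|k] p'] T1v; last discriminate T1v.
    case: p' T1v => [|[|p']] T1v; last discriminate T1v.
      exact: bdW D0 (bdX K (isT : order0 (inl j, 0%N))).
    exact: bdW dD (bf j).
  apply: dder_bd by_ => [v /sT|v /sT].
    by case: v => [[j|k] [|p']].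
  by case: v => [[j|k] [|p']].
exists h, w; split; last 1 first.
- move=> E pi piT pip piw; have pir := piT _ _ br r0.
  have pih : pi y = 0.
    apply: (rmorph_factor_eq0 (k := 1) (l := e.+1) pir); rewrite expr1.
    by apply: etrans (congr1 pi Eq) (rmorph_mul_eq0 s' pip).
  split; [exact: pih|exact: Hpi|exact: rmorph_factor_eq0 pir piw].
- split=> [i|]; last by exists (D * D.*2.+1 + D)%N; exact: by_.
  by exists (D * D.*2.+1)%N; exact: bh.
- exact: bw.
- have idP k : ideal (prolonged k) := idl_ideal _.
  have J0 : prolonged (D + 0) (r * y ^+ e.+1).
    by rewrite addn0 Eq; apply: idlM.
  pose J k := prolonged (D + k).
  have J_inc k a : J k a -> J k.+1 a by apply: prolongedS; rewrite addnS.
  have J_der k a : J k a -> J k.+1 (dder a).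
    by rewrite /J addnS; apply: prolonged_dder.
  have J_nat k i a : J k (i.+1%:R * a) -> J k a by apply: prolonged_nat.
  have Hw := derivative_power (@dder_derivation K n m) (J := J) (fun k => idP _)
    J_inc J_der J_nat J0.
  have Hw' : prolonged (D + D.+1) (r ^+ e.+2 * dder y ^+ (e.*2).+1).
    by apply: prolongedS Hw; rewrite leq_add2l.
  have : prolonged (D + D.+1) (state_subst f (dder y) ^+ (e.*2).+1 - dder y ^+ (e.*2).+1).
    apply: ideal_subX; first exact: idP.
    exact: prolongedS (leq0n _) (prolonged_subst _).
  move=> /(idlM (r ^+ e.+2)) H2; have := idlD H2 Hw'.
  by rewrite mulrBr subrK.
Qed.

Definition relation_vars (zs : seq V) z : pred V :=
  [pred v | (if state0 z then state0 v else order0 v) && ((v \notin zs) || (v == z))].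

Section EliminationStep.
Variables (D : nat) (zs : seq V) (pz : V -> R).
Hypotheses (dD : (d <= D)%N) (uzs : uniq zs) (zs0 : {subset zs <= order0}).
Hypothesis pz_n0 : forall z, z \in zs -> pz z != 0.
Hypothesis pz_prolonged : forall z, z \in zs -> prolonged D (pz z).
Hypothesis pz_bd : forall z, z \in zs -> bd (relation_vars zs z) D (pz z).

Let D0 : (0 < D)%N := leq_trans d_gt0 dD.

Let relation_self z : z \in zs -> relation_vars zs z z.
Proof. by move=> zin; rewrite /relation_vars /= eqxx orbT andbT; case: ifP => // _; apply: zs0. Qed.

Let relation_base z D' (c : R) :
  bd [pred v | relation_vars zs z v & v != z] D' c -> bd [pred v | v \notin zs] D' c.
Proof.
by apply: bd_sub => // v; rewrite !inE /= => /andP[/andP[_ /orP[//|->]]].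
Qed.

Let conseq_spec z (hw : {poly R} * R) := z \in zs -> state0 z ->
  [/\ (forall i, exists D', bd [pred v | relation_vars zs z v & v != z] D' hw.1`_i)
      /\ (exists D', bd (relation_vars zs z) D' hw.1.[<< ucm z >>]),
    bd order0 (21 * D ^ 4) hw.2, prolonged (D + D.+1) hw.2 &
    forall (E : fieldType) (pi : {rmorphism R -> E}),
      (forall D' c, bd [pred v | relation_vars zs z v & v != z] D' c -> c != 0 -> pi c != 0) ->
      pi (pz z) = 0 -> pi hw.2 = 0 ->
      [/\ pi hw.1.[<< ucm z >>] = 0, pi (hw.1^`()).[<< ucm z >>] != 0 &
          pi (state_subst f (dder hw.1.[<< ucm z >>])) = 0]].

Let conseq_exists z : exists hw, conseq_spec z hw.
Proof.
have [zin|nz] := boolP (z \in zs); last by exists (0, 0) => zin; rewrite zin in nz.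
have [sz|nsz] := boolP (state0 z); last by exists (0, 0) => _ sz; rewrite sz in nsz.
have sub : {subset relation_vars zs z <= state0}.
  by move=> v; rewrite inE /= sz => /andP[].
have [h [w Hw]] := state_consequence dD sz sub (relation_self zin) (pz_n0 zin)
  (pz_bd zin) (pz_prolonged zin).
by exists (h, w) => _ _; exact: Hw.
Qed.

Let consequences (hw : V -> {poly R} * R) (x : R) : Prop :=
  (exists k, x = g k) \/ (exists z, [/\ z \in zs, state0 z & x = (hw z).2]).

(** States take their [H] from [state_consequence], inputs from [separating_derivative];
    [differential_zero] then applies. *)
Let common_zero (hw : V -> {poly R} * R) (E : fieldType) (pi : {rmorphism R -> E}) :
  (forall z, conseq_spec z (hw z)) ->
  (forall e : E, exists a b, pi b != 0 /\ e = pi a / pi b) ->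
  (forall D' c, bd [pred v | v \notin zs] D' c -> c != 0 -> pi c != 0) ->
  (forall x, consequences hw x -> pi x = 0) ->
  (forall z, z \in zs -> pi (pz z) = 0) ->
  ~ diff_ideal_gen (lhs_gens f g) 1.
Proof.
move=> Hhw fracE pi_inj pi_cons pi_pz.
have pi_rel z D' c : bd [pred v | relation_vars zs z v & v != z] D' c -> c != 0 -> pi c != 0.
  by move=> /relation_base; apply: pi_inj.
have /choice[H HH] z : exists H : {poly R}, z \in zs ->
    [/\ forall i, exists D', bd [pred v | v \notin zs] D' H`_i,
        pi H.[<< ucm z >>] = 0, pi (H^`()).[<< ucm z >>] != 0 &
        state0 z -> (exists D', bd state0 D' H.[<< ucm z >>]) /\
          pi (state_subst f (dder H.[<< ucm z >>])) = 0].
  have [zin|nz] := boolP (z \in zs); last by exists 0 => zin; discriminate zin.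
  have [sz|nsz] := boolP (state0 z).
    have [[hb hb'] _ _ Hpi] := Hhw z zin sz.
    have pw0 : pi (hw z).2 = 0 by apply: pi_cons; right; exists z.
    have [h1 h2 h3] := Hpi E pi (pi_rel z) (pi_pz z zin) pw0.
    exists (hw z).1 => _; split=> // [i|_].
      by have [D' b] := hb i; exists D'; exact: relation_base b.
    split=> //; have [D' b] := hb'; exists D'; apply: (bd_sub _ (leqnn _) b) => v.
    by rewrite inE /= sz => /andP[].
  have bP i := bdp_coef i (tau_bdp z (pz_bd zin)).
  have Pn0 : tau z (pz z) != 0 by rewrite tau_eq0; apply: pz_n0.
  have P0 : pi (tau z (pz z)).[<< ucm z >>] = 0 by rewrite tauK; apply: pi_pz.
  have [H [bH H0 H1]] := separating_derivative char0 Pn0 bP (pi_rel z D) P0.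
  exists H => _; split; [|exact: H0|exact: H1|by move=> sz; discriminate sz].
  by move=> i; exists D; exact: relation_base (bH i).
apply: (@differential_zero _ _ _ _ f g E pi zs H fracE).
- by move=> k; apply: pi_cons; left; exists k.
- by move=> j; exists d; apply: bf.
- by move=> k; exists d; apply: bg.
- exact: pi_inj.
- by move=> z i zin; have [] := HH z zin.
- by move=> z zin; have [] := HH z zin.
- by move=> z zin; have [] := HH z zin.
move=> j p zin; have [_ _ _] := HH _ zin; apply.
by have v0 := zs0 zin; rewrite /state0 /= andbT; exact: v0.
Qed.

Lemma elimination_step : diff_ideal_gen (lhs_gens f g) 1 ->
  exists c, [/\ c != 0,
    bd [pred v | order0 v && (v \notin zs)] (elim_bound (size zs) (21 * D ^ 4)) c &
    prolonged (D + D.+1) c].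
Proof.
move=> H1; have [hw Hhw] := choice conseq_exists.
pose W := consequences hw.
pose G (x : R) := W x \/ exists2 z, z \in zs & x = pz z.
(* Derivatives may occur in [M], so the element [c] found next is bounded neither in degree nor in
   order; [elimination] trades it for one of order zero and bounded degree. *)
pose M (c : R) := c != 0 /\ exists D', bd [pred v | v \notin zs] D' c.
have [c [[c0 [Dc bc]] Gc]] : exists c : R, M c /\ idl G c.
  apply: contrapT => disj.
  have M1 : M 1 by split; [exact: oner_neq0|exists 0%N; exact: bd1].
  have MM a b : M a -> M b -> M (a * b).
    move=> [a0 [Da ba]] [b0 [Db bb]].
    by split; [exact: malg_mulf_neq0|exists (Da + Db)%N; exact: bdM].
  have avoid x : M x -> ~ idl G x by move=> Mx Ix; apply: disj; exists x.
  have [P [idP GP MP primeP]] := @prime_avoiding R (idl G) M (idl_ideal G) MM avoid.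
  have [E [pi [ker fracE]]] := residue_field idP (MP _ M1) primeP.
  apply: (common_zero Hhw fracE _ _ _ H1).
  - move=> D' c bc c0; apply/eqP => /ker; apply: MP; split=> //; by exists D'.
  - by move=> x Wx; apply/ker/GP/idl_gen; left.
  - by move=> z zin; apply/ker/GP/idl_gen; right; exists z.
have B0 : (0 < 21 * D ^ 4)%N by rewrite muln_gt0 expn_gt0 D0.
have leDB : (D <= 21 * D ^ 4)%N.
  by apply: leq_trans (leq_pmull _ _) => //; rewrite -{1}[D]expn1 leq_pexp2l.
have [|||c' [c'0 bc' Gc']] := elimination (T := [pred v | order0 v && (v \notin zs)])
  (D := 21 * D ^ 4) (W := W) (pz := pz) uzs B0 _ _ _ c0 bc Gc.
- by move=> z zin; rewrite /= zin andbF.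
- move=> z zin; split; first exact: pz_n0.
  apply: (bd_sub _ leDB (pz_bd zin)) => v; rewrite !inE /= => /andP[+ /orP[->|->]]; rewrite ?orbT //.
  by rewrite andbT; case: ifP => [_ /andP[v0 _]|_ v0]; apply/orP; left.
- move=> w [[k ->]|[z [zin sz ->]]].
    apply: (bd_sub _ _ (bg k)) => [v v0|]; last exact: leq_trans dD leDB.
    by rewrite !inE; case: (v \in zs); rewrite ?orbT // andbT orbF; exact: v0.
  have [_ bw _ _] := Hhw z zin sz.
  apply: (bd_sub _ (leqnn _) bw) => v v0.
  by rewrite !inE; case: (v \in zs); rewrite ?orbT // andbT orbF; exact: v0.
exists c'; split; [exact: c'0|exact: bc'|].
apply: idl_min Gc' => [|x [[[k ->]|[z [zin sz ->]]]|[z zin ->]]]; first exact: idl_ideal.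
- by apply/idl_gen/mem_rhs_gens; right; exists 0%N, k.
- by have [_ _ +] := Hhw z zin sz.
- by apply: prolongedS (pz_prolonged zin); rewrite leq_addr.
Qed.

End EliminationStep.

End Step.

(** * Iteration and bounds *)

Section Bounds.
Local Open Scope nat_scope.

(** Doubling turns the recursion into squaring: 2 (2 D^2) = (2 D)^2. *)
Lemma elim_boundE k D : 2 * elim_bound k D = (2 * D) ^ (2 ^ k).
Proof.
elim: k D => [|k IH] D; first by rewrite expn1.
rewrite /elim_bound iterSr IH [2 ^ k.+1]expnS expnM; congr (_ ^ _).
by rewrite expnS expn1; nia.
Qed.

Definition step_bound N D := elim_bound N (21 * D ^ 4).

Lemma step_bound_exp N b D E : 1 < b -> 0 < E -> D <= b ^ E ->
  step_bound N D <= b ^ (E * 2 ^ (N + 4)).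
Proof.
move=> b1 E0 leD; apply: leq_trans (_ : 2 * step_bound N D <= _); first by rewrite leq_pmull.
rewrite elim_boundE.
(* Twice 21 is at most b^6, and 6 + 4 E is at most 10 E; bounding 10 by 2^4 gives the shift to N +
   4. *)
apply: leq_trans (_ : (b ^ (10 * E)) ^ (2 ^ N) <= _); last first.
  rewrite -expnM leq_exp2l // expnD; have := expn_gt0 2 N; nia.
rewrite leq_exp2r ?expn_gt0 //.
apply: leq_trans (_ : b ^ 6 * (b ^ E) ^ 4 <= _); last first.
  by rewrite -expnM -expnD leq_exp2l //; lia.
rewrite mulnA; apply: leq_mul; last by rewrite leq_exp2r.
by apply: leq_trans (_ : 2 ^ 6 <= _) => //; rewrite leq_exp2r.
Qed.

Lemma iter_step_bound N b d t : 1 < b -> d <= b ->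
  iter t (step_bound N) d <= b ^ (2 ^ ((N + 4) * t)).
Proof.
move=> b1 db; elim: t => [|t IH]; first by rewrite muln0 expn0 expn1.
rewrite iterS; apply: leq_trans (step_bound_exp N b1 _ IH) _; first by rewrite expn_gt0.
by rewrite leq_exp2l // -expnD leq_exp2l //; lia.
Qed.

Lemma step_bound_gt0 N D : 0 < D -> 0 < step_bound N D.
Proof.
move=> D0; have B0 : 0 < 21 * D ^ 4 by rewrite muln_gt0 expn_gt0 D0.
exact: leq_trans B0 (elim_bound_ge _ B0).
Qed.

(** One quantity can thus bound both the degree and the number of derivations, which a step raises
    from [D] to [D + D.+1]. *)
Lemma step_bound_ge N D : 0 < D -> D + D.+1 <= step_bound N D.
Proof.
move=> D0; have B0 : 0 < 21 * D ^ 4 by rewrite muln_gt0 expn_gt0 D0.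
apply: leq_trans (elim_bound_ge _ B0).
have : D ^ 1 <= D ^ 4 by rewrite leq_pexp2l.
rewrite expn1; lia.
Qed.

Lemma exponent_bound n m : 0 < n + m ->
  (n + m + 4) * (n * m.+1 + m).+1 <= 15 * (n + m) ^ 3.
Proof.
move=> N0; apply: leq_trans (_ : (5 * (n + m)) * (3 * (n + m) ^ 2) <= _).
  by apply: leq_mul; [lia|rewrite expnS expn1; nia].
by rewrite mulnACA -expnS.
Qed.

End Bounds.

(** * Induction on the set of eliminated variables *)

Section Iteration.
Variables (K : fieldType) (n m s : nat).
Hypothesis char0 : [pchar K] =i pred0.
Local Notation V := (dvar n m).
Local Notation R := {malg K[{cmonom V}]}.
Local Notation W := ('I_n + 'I_m)%type.
Variables (f : 'I_n -> R) (g : 'I_s -> R) (d : nat).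
Hypothesis d_gt0 : (0 < d)%N.
Hypothesis bf : forall j, bd order0 d (f j).
Hypothesis bg : forall k, bd order0 d (g k).
Hypothesis inconsistent : diff_ideal_gen (lhs_gens f g) 1.

Definition inputs : {set W} := [set w | if w is inr _ then true else false].
(** A state weighs [m.+1], so that removing it pays for the return of up to [m] inputs. *)
Definition rank (Z : {set W}) : nat := (#|Z :\: inputs| * m.+1 + #|Z :&: inputs|)%N.
Definition vars (Z : {set W}) : seq V := [seq (w, 0%N) | w <- enum Z].

Let mem_vars (Z : {set W}) (v : V) : v.2 = 0%N -> (v \in vars Z) = (v.1 \in Z).
Proof.
case: v => w p /= ->; apply/mapP/idP => [[w' + [->]]|wZ]; first by rewrite mem_enum.
by exists w => //; rewrite mem_enum.
Qed.

Let card_inputs : (#|inputs| <= m)%N.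
Proof.
have -> : inputs = [set inr k | k : 'I_m].
  apply/setP => -[j|k]; rewrite inE; apply/esym/imsetP; last by exists k.
  by case.
by apply: leq_trans (leq_imset_card _ _) _; rewrite card_ord.
Qed.

Let card_states : (#|~: inputs| <= n)%N.
Proof.
have -> : ~: inputs = [set inl j | j : 'I_n].
  apply/setP => -[j|k]; rewrite !inE; apply/esym/imsetP; first by exists j.
  by case.
by apply: leq_trans (leq_imset_card _ _) _; rewrite card_ord.
Qed.

Let rank_state (Z : {set W}) j : inl j \in Z -> (rank ((Z :\ inl j) :|: inputs) < rank Z)%N.
Proof.
move=> jZ; rewrite /rank.
have -> : ((Z :\ inl j) :|: inputs) :\: inputs = (Z :\: inputs) :\ inl j.
  by apply/setP => w; rewrite !inE; case: w => w //=; rewrite ?andbF ?orbF.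
have -> : ((Z :\ inl j) :|: inputs) :&: inputs = inputs.
  by apply/setP => w; rewrite !inE; case: w => w //=; rewrite ?andbF ?orbT.
rewrite (cardsD1 (inl j) (Z :\: inputs)) !inE jZ /= add1n mulSn.
by rewrite -addnA addnCA ltn_add2l addSn ltnS (leq_trans card_inputs) ?leq_addr.
Qed.

Let rank_input (Z : {set W}) k : inr k \in Z -> (rank (Z :\ inr k) < rank Z)%N.
Proof.
move=> kZ; rewrite /rank.
have -> : (Z :\ inr k) :\: inputs = Z :\: inputs.
  by apply/setP => w; rewrite !inE; case: w => w //=; rewrite ?andbF.
have -> : (Z :\ inr k) :&: inputs = (Z :&: inputs) :\ inr k.
  by apply/setP => w; rewrite !inE andbA.
by rewrite ltn_add2l (cardsD1 (inr k) (Z :&: inputs)) !inE kZ.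
Qed.

Let card_W : #|{: W}| = (n + m)%N. Proof. by rewrite card_sum !card_ord. Qed.

Let beta t := iter t (step_bound (n + m)) d.

Let beta_ge t : (d <= beta t)%N.
Proof.
elim: t => [|t IH] //; apply: leq_trans IH _; rewrite /beta iterS.
apply: leq_trans (step_bound_ge _ _); first by rewrite leq_addr.
by elim: t => [|t IH] //; rewrite iterS step_bound_gt0.
Qed.

(** The strict inequality makes [t = 0] vacuous. The empty [Z], of rank 0, still costs one step, in
    which the constraints [g] alone supply the element. *)
Lemma eliminate_vars t (Z : {set W}) : (rank Z < t)%N ->
  exists c : R, [/\ c != 0, bd [pred v | order0 v && (v \notin vars Z)] (beta t) c &
    prolonged f g (beta t) c].
Proof.
elim: t Z => // t IH Z; rewrite ltnS => rankZ.
have uvars : uniq (vars Z) by rewrite map_inj_uniq ?enum_uniq // => w w' [].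
have vars0 : {subset vars Z <= order0} by move=> v /mapP[w _ ->].
have /choice[p Hp] z : exists p : R, z \in vars Z ->
    [/\ p != 0, bd (relation_vars (vars Z) z) (beta t) p & prolonged f g (beta t) p].
  have [/mapP[w + ->]|_] := boolP (z \in vars Z); last by exists 0.
  rewrite mem_enum; case: w => [j|k] wZ.
    (* The smaller set contains all inputs, so this relation involves only the state at hand and
       states outside [Z]. *)
    have [p [p0 bp Ip]] := IH _ (leq_trans (rank_state wZ) rankZ).
    exists p => _; split; [exact: p0| |exact: Ip].
    apply: (bd_sub _ (leqnn _) bp) => v /andP[v0 vnZ]; have v2 : v.2 = 0%N by apply/eqP.
    rewrite mem_vars // !inE negb_or negb_and negbK in vnZ.
    case: v v0 v2 vnZ => [[j'|k'] p'] v0 /= -> /andP[+ vst]; last discriminate vst.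
    rewrite inE /relation_vars /= mem_vars // => /orP[/eqP[->]|jn]; first by rewrite eqxx orbT.
    by rewrite jn.
  have [p [p0 bp Ip]] := IH _ (leq_trans (rank_input wZ) rankZ).
  exists p => _; split; [exact: p0| |exact: Ip].
  apply: (bd_sub _ (leqnn _) bp) => v /andP[v0 vnZ]; have v2 : v.2 = 0%N by apply/eqP.
  rewrite mem_vars // !inE negb_and negbK in vnZ.
  case: v v0 v2 vnZ => [w' p'] v0 /= -> ; rewrite inE /relation_vars /= mem_vars //.
  by case/orP=> [/eqP -> | ->]; rewrite ?eqxx ?orbT.
have [z zin|z zin|z zin||c [c0 bc Ic]] := @elimination_step K n m s char0 f g d d_gt0 bf bg
  (beta t) (vars Z) p (beta_ge t) uvars vars0.
- by have [] := Hp z zin.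
- by have [] := Hp z zin.
- by have [] := Hp z zin.
- exact: inconsistent.
have beta0 : (0 < beta t)%N := leq_trans d_gt0 (beta_ge t).
exists c; split=> //; last first.
  by apply: prolongedS Ic; rewrite {3}/beta iterS step_bound_ge.
apply: bdW bc; rewrite {2}/beta iterS; apply: elim_bound_mono => //.
  by rewrite muln_gt0 expn_gt0 beta0.
by rewrite size_map -cardE -card_W max_card.
Qed.

Lemma prolonged_const L c : c != 0 -> prolonged f g L c%:MP -> prolonged f g L 1.
Proof.
move=> c0 /(idlM (c^-1)%:MP); rewrite -mpolyCM mulVf // mpolyC1E.
Qed.

Lemma prolonged_iter_bound : prolonged f g (beta (n * m.+1 + m).+1) 1.
Proof.
have [|c [c0 bc Ic]] := @eliminate_vars (n * m.+1 + m).+1 [set: W].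
  by rewrite ltnS /rank setTI setTD leq_add ?card_inputs // leq_mul2r card_states orbT.
have [v|c' Ec] := bd_const _ bc.
  rewrite /=; apply/negP => /andP[v0]; rewrite mem_vars ?inE //; exact/eqP.
rewrite Ec in c0 Ic; apply: (prolonged_const _ Ic).
by apply: contraNneq c0 => ->; rewrite malgC0E.
Qed.

End Iteration.

(** * Comparison of the ideal notions *)

Section IdealConversions.
Variables (K : fieldType) (n m s : nat).
Local Notation V := (dvar n m).
Local Notation R := {malg K[{cmonom V}]}.
Variables (f : 'I_n -> R) (g : 'I_s -> R).

Lemma idl_lincomb (F : seq (dpoly K n m)) (x : R) :
  idl (fun h : R => (h : dpoly K n m) \in F) x ->
  exists a : seq (dpoly K n m), size a = size F /\ x = \sum_(i < size F) a`_i * F`_i.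
Proof.
move=> Hx; pose I (y : R) := exists a : nat -> R, y = \sum_(i < size F) a i * F`_i.
have [a ->] : I x.
  apply: idl_min Hx => [|h hF].
    split=> [|y z [a ->] [b ->]|r y [a ->]].
    - by exists (fun=> 0); rewrite big1 // => i _; rewrite mul0r.
    - exists (fun i => a i + b i); rewrite -big_split; apply: eq_bigr => i _.
      exact: esym (mulrDl _ _ _).
    - exists (fun i => r * a i); rewrite mulr_sumr; apply: eq_bigr => i _.
      exact: mulrA.
  have hlt : (index h F < size F)%N by rewrite index_mem.
  exists (fun i => if i == index h F then 1 else 0).
  rewrite (bigD1 (Ordinal hlt)) //= eqxx mul1r nth_index // big1 ?addr0 // => i ne.
  by rewrite ifN ?mul0r //; apply: contraNneq ne => E; apply/eqP/val_inj.
exists (mkseq a (size F)); split; first exact: size_mkseq.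
by apply: eq_bigr => i _; rewrite nth_mkseq.
Qed.

(** Setting to zero the variables that do not occur in [F] is a ring morphism fixing [F] and 1; it
    moves the cofactors of a representation of 1 into the required polynomial ring. *)
Lemma idl_poly_ideal_gen (F : seq (dpoly K n m)) :
  idl (fun h : R => (h : dpoly K n m) \in F) 1 -> poly_ideal_gen F 1.
Proof.
move=> /idl_lincomb[a [sa E]].
pose T : pred V := fun v => has (fun h => dvars h v) F.
pose sg : R -> R := ev (@malgC {cmonom V} K) (fun v => if T v then << ucm v >> else 0).
have sgT (h : R) : vars_in T (sg h : dpoly K n m).
  have [D bh] := bd_total h.
  have : bd T (D * 1) (sg h).
    apply: (ev_bd _ bh) => v _; case: ifP => [Tv|_]; [exact: bdX|exact: bd0].
  by move=> /bdP H v /hasP[mo mo_h v_mo]; have [_] := H mo mo_h; apply.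
have sgF h : h \in F -> sg h = h.
  move=> hF; have [D bh] : exists D, bd T D h.
    apply: bd_exists => mo v mo_h v_mo; apply/hasP; exists h => //.
    by apply/hasP; exists mo.
  apply/esym/(eq_ev_on (F := idfun) (T := T) _ _ bh) => // v Tv.
  by rewrite Tv.
exists (map sg a); split; first by rewrite size_map.
split=> [c /mapP[b _ ->]|]; first exact: sgT.
have sg1 : sg 1 = 1 by apply: rmorph1.
rewrite -[LHS]sg1 E; apply: etrans (raddf_sum _ _ _ _) _; apply: eq_bigr => i _.
rewrite (nth_map 0) ?sa //; apply: etrans (rmorphM _ _ _) _.
by congr (_ * _); apply: sgF; apply: mem_nth.
Qed.

Lemma poly_ideal_gen_diff L :
  poly_ideal_gen (rhs_gens L f g) 1 -> diff_ideal_gen (lhs_gens f g) 1.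
Proof.
move=> [a [_ [_ ->]]] I [[I0 ID IM] Ider] Igen.
have iter_der p h : I h -> I (dderN p h).
  by move=> Ih; elim: p => // p; apply: Ider.
elim/big_ind: _ => [|x y|i _] //; first exact: ID.
apply: IM; have : (rhs_gens L f g)`_i \in rhs_gens L f g by apply: mem_nth.
move=> /mem_rhs_gens[[p [j [_ ->]]]|[p [k [_ ->]]]]; last first.
  apply: iter_der; apply: Igen; rewrite mem_cat; apply/orP; right.
  by apply/mapP; exists k; rewrite ?mem_enum.
have -> : << ucm (inl j, p.+1) >> - dderN p (f j) = dderN p (dX K (inl j, 1%N) - f j).
  elim: p => // p IH; rewrite /dderN !iterS -!/(dderN _ _) -IH.
  by rewrite (derB (@dder_derivation K n m)) dderX.
apply: iter_der; apply: Igen; rewrite mem_cat; apply/orP; left.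
by apply/mapP; exists j; rewrite ?mem_enum.
Qed.

End IdealConversions.

Lemma der_affine (R : comNzRingType) (D : R -> R) e c x :
  derivation_over (idfun : {rmorphism R -> R}) D -> D e = 0 -> D c = 0 ->
  D (e + c * x) = c * D x.
Proof. by move=> DP De Dc; rewrite (derD DP) (derM DP) De Dc mul0r !add0r. Qed.

(** * Cases in which the exponential bound is 0 or 1 *)

Section SmallCases.
Variables (K : fieldType) (n m s : nat).
Local Notation V := (dvar n m).
Local Notation R := {malg K[{cmonom V}]}.
Variables (f : 'I_n -> R) (g : 'I_s -> R) (d : nat).
Hypothesis bf : forall j, bd order0 d (f j).
Hypothesis bg : forall k, bd order0 d (g k).
Hypothesis inconsistent : diff_ideal_gen (lhs_gens f g) 1.

(** If all constraints vanished, x' = f alone would have a zero over the fraction field of the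
    polynomial ring, with no relation imposed on the variables. *)
Lemma nonzero_constraint : exists k, g k != 0.
Proof.
apply: contrapT => none; have [E [iota [inj fracE]]] := @malg_frac K V.
have g0 k : g k = 0.
  by have [//|gk] := eqVneq (g k) 0; case: none; exists k.
apply: (@differential_zero K n m s f g E iota [::] (fun=> 0) fracE) inconsistent => //.
- by move=> k; rewrite g0; apply: rmorph0.
- by move=> j; exists d; apply: bf.
- by move=> k; exists d; apply: bg.
- move=> D c _; apply: contra_neq => Ec; apply: inj.
  by rewrite Ec rmorph0.
Qed.

Lemma affine_form v0 : (forall v, order0 v -> v = v0) ->
  forall h : R, bd order0 1 h -> exists a b, h = a%:MP + b%:MP * << ucm v0 >>.
Proof.
move=> only h bh; have bt := tau_bdp v0 bh.
have noT v : ~~ [pred v | order0 v & v != v0] v.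
  by rewrite /= negb_and negbK -implybE; apply/implyP => /only ->.
have [a Ea] := bd_const noT (bdp_coef 0 bt); have [b Eb] := bd_const noT (bdp_coef 1 bt).
exists a, b; rewrite -[LHS](tauK v0) (horner_coef_wide _ (bdp_size bt)).
by rewrite big_ord_recl big_ord1 /= expr0 mulr1 expr1 Ea Eb.
Qed.

Section OneVariable.
Variable v0 : V.
Hypotheses (only : forall v, order0 v -> v = v0) (v00 : order0 v0).
Hypothesis d1 : d = 1%N.

(** A candidate constant solution: derivatives go to zero, so the kernel of [spec xi] is a
    differential ideal. *)
Let spec (xi : K) : {rmorphism R -> K} :=
  ev (idfun : {rmorphism K -> K}) (fun v => if order0 v then xi else 0).

Let specC xi c : spec xi c%:MP = c. Proof. exact: evC. Qed.
Let specX xi v : spec xi << ucm v >> = if order0 v then xi else 0. Proof. exact: evX. Qed.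

Let spec_dder xi h : spec xi (dder h) = 0.
Proof.
have [D bh] := bd_total h.
have zero_der : derivation_over (spec xi) (fun=> 0).
  by split=> a b; rewrite ?addr0 // mul0r mulr0 addr0.
apply: (derivation_eq_on (derivation_comp (spec xi) (@dder_derivation K n m)) zero_der _ _ bh).
  by move=> c; have -> : dder (c%:MP : R) = 0 := dderC _ _ c; apply: rmorph0.
by move=> v _; have -> : dder (<< ucm v >> : R) = << ucm (shiftv v) >> := dderX _ v; rewrite specX.
Qed.

Let no_constant_solution xi : (forall j, spec xi (f j) = 0) ->
  (forall k, spec xi (g k) = 0) -> False.
Proof.
move=> f0 g0; have : spec xi 1 = 0.
  apply: (inconsistent (I := fun r => spec xi r = 0)).
    split; last by move=> a _; apply: spec_dder.
    split=> [|a b Ea Eb|r a Ea]; first exact: rmorph0.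
      by apply: etrans (rmorphD (spec xi) a b) _; rewrite Ea Eb addr0.
    exact: rmorph_mul_eq0.
  move=> h; rewrite mem_cat => /orP[] /mapP[j _ ->]; last exact: g0.
  apply: etrans (rmorphB (spec xi) _ _) _; rewrite f0 subr0.
  by apply: specX.
by rewrite rmorph1; apply/eqP; rewrite oner_eq0.
Qed.

Let malgCM (x y : K) : (x * y)%:MP = x%:MP * y%:MP :> R.
Proof. exact: mpolyCM. Qed.

Let malgCB (x y : K) : (x - y)%:MP = x%:MP - y%:MP :> R.
Proof. exact: raddfB. Qed.

Let mul_affine (A : comNzRingType) (u e c x : A) : u * (e + c * x) = u * e + u * c * x.
Proof. by rewrite mulrDr mulrA. Qed.

Let sub_common (A : comNzRingType) (p q r : A) : p + r - (q + r) = p - q.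
Proof. by rewrite opprD addrACA subrr addr0. Qed.

(** A nonzero affine constraint e + c v0 is a unit or has a single root [xi], and modulo it every
    affine polynomial equals its value at [xi]. A nonzero value of some [g k] or [f j] gives a unit
    in the ideal; for [f j], one derivation of the constraint brings in x', hence level 1. If all
    values vanish, [xi] is a constant solution. *)
Lemma one_variable : prolonged f g 1 1.
Proof.
have [k0 g0] := nonzero_constraint.
have bf1 j : bd order0 1 (f j) by rewrite -d1.
have bg1 k : bd order0 1 (g k) by rewrite -d1.
have [e [c Eg]] := affine_form only (bg1 k0).
have Ig k : prolonged f g 0 (g k).
  by apply/idl_gen/mem_rhs_gens; right; exists 0%N, k.
have [c0|c0] := eqVneq c 0.
  have Eg' : g k0 = e%:MP by rewrite Eg c0 malgC0E mul0r addr0.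
  have e0 : e != 0 by apply: contraNneq g0 => e0; rewrite Eg' e0 malgC0E.
  by apply: prolonged_const e0 _; rewrite -Eg'; apply: prolongedS (leq0n 1) (Ig k0).
pose xi := - e / c.
have value h : bd order0 1 h -> exists b, (spec xi h)%:MP = h - b%:MP * g k0.
  move=> /(affine_form only)[a [b ->]]; exists (b / c).
  have -> : spec xi (a%:MP + b%:MP * << ucm v0 >>) = a + b * xi.
    apply: etrans (rmorphD (spec xi) _ _) _; apply: (congr2 +%R); first exact: specC.
    apply: etrans (rmorphM (spec xi) _ _) _; apply: (congr2 *%R); first exact: specC.
    by apply: etrans (specX xi v0) _; rewrite v00.
  have Ebc : (b / c)%:MP * (e%:MP + c%:MP * << ucm v0 >>) = (b / c * e)%:MP + b%:MP * << ucm v0 >> :> R.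
    apply: etrans (mul_affine _ _ _ _) _; apply: (congr2 +%R); first exact: esym (malgCM (b / c) e).
    apply: (congr1 (fun y : R => y * _)); apply: etrans (esym (malgCM (b / c) c)) _.
    by apply: (congr1 (@malgC {cmonom V} K)); rewrite divfK.
  have Eq : (b / c)%:MP * g k0 = (b / c * e)%:MP + b%:MP * << ucm v0 >> :> R.
    exact: etrans (congr1 (fun y : R => (b / c)%:MP * y) Eg) Ebc.
  apply: esym; apply: etrans (congr1 (fun y : R => a%:MP + b%:MP * << ucm v0 >> - y) Eq) _.
  apply: etrans (sub_common _ _ _) _; apply: etrans (esym (malgCB a (b / c * e))) _.
  apply: (congr1 (@malgC {cmonom V} K)).
  by rewrite /xi mulrA mulrN mulNr [b / c * e]mulrAC.
have [[k nk]|allg] := pselect (exists k, spec xi (g k) != 0).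
  have [b Eb] := value _ (bg1 k); apply: (prolonged_const nk); rewrite Eb.
  apply: (idealB (idl_ideal _ : ideal (prolonged f g 1))); first exact: prolongedS (leq0n 1) (Ig k).
  exact: idlM (prolongedS (leq0n 1) (Ig k0)).
have [[j nj]|allf] := pselect (exists j, spec xi (f j) != 0); last first.
  case: (no_constant_solution (xi := xi)) => [j|k].
    by have [//|nj] := eqVneq (spec xi (f j)) 0; case: allf; exists j.
  by have [//|nk] := eqVneq (spec xi (g k)) 0; case: allg; exists k.
have [b Eb] := value _ (bf1 j); apply: (prolonged_const nj); rewrite Eb.
apply: (idealB (idl_ideal _ : ideal (prolonged f g 1))); last exact: idlM (prolongedS (leq0n 1) (Ig k0)).
have vj : v0 = (inl j, 0%N) by rewrite -(only (v := (inl j, 0%N))).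
have Ix : prolonged f g 1 (<< ucm (shiftv v0) >> : R).
  have := prolonged_dder (Ig k0); rewrite Eg.
  have -> : dder (e%:MP + c%:MP * << ucm v0 >> : R) = c%:MP * << ucm (shiftv v0) >>.
    have Dc (x : K) : dder (x%:MP : R) = 0 := dderC _ _ x.
    apply: etrans (der_affine << ucm v0 >> (@dder_derivation K n m) (Dc e) (Dc c)) _.
    by apply: congr1; apply: dderX.
  by move=> /(idlM (c^-1)%:MP); rewrite mulrA -mpolyCM mulVf // mpolyC1E mul1r.
have -> : f j = << ucm (shiftv v0) >> - (<< ucm (inl j, 1%N) >> - f j).
  by rewrite vj opprB addrCA subrr addr0.
apply: (idealB (idl_ideal _ : ideal (prolonged f g 1))) => //.
by apply/idl_gen/mem_rhs_gens; left; exists 0%N, j.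
Qed.

End OneVariable.
End SmallCases.

Theorem theorem6p1 :
  exists c : nat, (0 < c)%N /\
  forall (K : fieldType), [pchar K] =i pred0 ->
  forall (n m s : nat) (f : 'I_n -> dpoly K n m) (g : 'I_s -> dpoly K n m)
         (d : nat),
    (forall j, in_Kxu (f j)) -> (forall k, in_Kxu (g k)) ->
    (0 < d)%N ->
    (forall j, (tdeg (f j) <= d)%N) -> (forall k, (tdeg (g k) <= d)%N) ->
    let L := (((n + m) * d) ^ (2 ^ (c * (n + m) ^ 3)))%N in
    (diff_ideal_gen (lhs_gens f g) 1 <-> poly_ideal_gen (rhs_gens L f g) 1).
Proof.
exists 15; split=> // K char0 n m s f g d f0 g0 d_gt0 df dg L.
split; last exact: poly_ideal_gen_diff.
move=> H1; apply: idl_poly_ideal_gen.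
have bf j : bd order0 d (f j) := bd_vars_in (f0 j) (df j).
have bg k : bd order0 d (g k) := bd_vars_in (g0 k) (dg k).
change (prolonged f g L 1).
(* Without variables a nonzero constraint is a nonzero constant and lies in the ideal before any
   derivation, which suits [L = 0]. *)
have [N0|N_gt0] := posnP (n + m).
  have [k gk] := nonzero_constraint bf bg H1.
  have [v|c Ec] := bd_const _ (bg k).
    by case: v => [[[j lt]|[j lt]] p]; move: N0 lt; case: (n) (m) => [|?] [|?].
  apply: (@prolonged_const _ _ _ _ f g L c); first by apply: contraNneq gk => c0; rewrite Ec c0 malgC0E.
  by rewrite -Ec; apply/idl_gen/mem_rhs_gens; right; exists 0%N, k.
(* With base 1 the bound stays 1 whatever the exponent, so the iteration is of no help; there is
   then one variable and degree one. *)
have [b1|b_gt1] := leqP ((n + m) * d) 1.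
  have EL : L = 1%N.
    have -> : L = (((n + m) * d) ^ (2 ^ (15 * (n + m) ^ 3)))%N by [].
    have -> : ((n + m) * d = 1)%N by apply/eqP; rewrite eqn_leq b1 muln_gt0 N_gt0.
    exact: exp1n.
  have N1 : (n + m = 1)%N by nia.
  have d1 : d = 1%N by nia.
  have [w Ww] : exists w : 'I_n + 'I_m, forall w', w' = w.
    have card1 : #|{: 'I_n + 'I_m}| = 1%N by rewrite card_sum !card_ord.
    have [w Ew] := fintype1 card1; exists w => w'; exact: Ew.
  have only v : order0 v -> v = (w, 0%N) :> dvar n m.
    by case: v => w' p /eqP /= ->; rewrite (Ww w').
  by rewrite EL; apply: (one_variable bf bg H1 only _ d1).
apply: prolongedS (prolonged_iter_bound char0 d_gt0 bf bg H1).
have db : (d <= (n + m) * d)%N by rewrite leq_pmull.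
apply: leq_trans (iter_step_bound (n + m) _ b_gt1 db) _.
by rewrite leq_exp2l // leq_exp2l //; apply: exponent_bound.
Qed.
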